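(* Let $\gamma:\mathbb{R}^2\to\mathbb{R}^3\simeq su(2)$ be a smooth solution of $\gamma_t=\frac12\gamma_x\times\gamma_{xx}$ parametrized by arc-length, $g$ an adapted p-frame along $\gamma$ with principal curvatures $k_1,k_2$, and $q=\frac12(k_1+ik_2)$ the corresponding solution of the NLS $q_t=\frac{i}{2}(q_{xx}+2|q|^2q)$. Let $\phi_0\in SU(2)$ with $g(0,0)=\mathrm{Ad}(\phi_0)[\delta]$ and let $E(x,t,\lambda)$ be the frame of $q$ with $E(0,0,\lambda)=\phi_0$ for all $\lambda$. Let $\alpha\in\mathbb{C}\setminus\mathbb{R}$, $v_0\in\mathbb{C}^2\setminus\{0\}$, let $y=(y_1,y_2)^t=E(\cdot,\cdot,\alpha)^{-1}v_0$, let $\tilde\pi(x,t)$ be the Hermitian projection of $\mathbb{C}^2$ onto $\mathbb{C}y(x,t)$, and let $\phi(x,t)=E(x,t,0)$. Then $$\tilde\gamma=\gamma-\frac{\alpha-\bar\alpha}{|\alpha|^2}\,\phi\,\tilde\pi_*\,\phi^{-1},\qquad \tilde\pi_*=\tilde\pi-\tfrac12I_2,$$ is a solution of $\tilde\gamma_t=\frac12\tilde\gamma_x\times\tilde\gamma_{xx}$ parametrized by arc-length. Moreover, let $\tilde\phi=\phi\left(\tilde\pi+\frac{\alpha}{\bar\alpha}\tilde\pi^\perp\right)$ with $\tilde\pi^\perp=I_2-\tilde\pi$, and let $\tilde g=\mathrm{Ad}(\tilde\phi)[\delta]$. Then: (i) $\tilde g(\cdot,t)$ is a p-frame along $\tilde\gamma(\cdot,t)$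 for each $t$, with principal curvatures $\tilde k_1,\tilde k_2$ say; (ii) $\tilde q=\frac12(\tilde k_1+i\tilde k_2)=q+2i(\alpha-\bar\alpha)\frac{y_1\bar y_2}{|y_1|^2+|y_2|^2}$ is a solution of the NLS; (iii) $\tilde E(x,t,\lambda)=E(x,t,\lambda)f_{\alpha,\tilde\pi(x,t)}(\lambda)^{-1}$ is a frame for $\tilde q$.
   Context: Let $a=\mathrm{diag}(i,-i)$, $b=\begin{pmatrix}0&1\\-1&0\end{pmatrix}$, $c=\begin{pmatrix}0&i\\i&0\end{pmatrix}$. Identify $su(2)$ with Euclidean $\mathbb{R}^3$ by $xa+yb+zc\mapsto(x,y,z)^t$; then the inner product is $-\frac12\mathrm{tr}(XY)$ and $X\times Y=\frac12[X,Y]$. Set $\delta=(a,-c,b)$, and for $\phi\in U(2)$ let $\mathrm{Ad}(\phi)[\delta]=(\phi a\phi^{-1},-\phi c\phi^{-1},\phi b\phi^{-1})\in SO(3)$. A p-frame along an arc-length parametrized curve is $(e_0,e_1,e_2)\in SO(3)$ with $e_0$ the tangent and $(e_1,e_2)$ parallel in the normal bundle; the principal curvatures are $k_i=(e_0)_x\cdot e_i$, $i=1,2$. An adapted p-frame along a solution $\gamma$ of the curve flow is a smooth $g=(e_0,e_1,e_2):\mathbb{R}^2\to SO(3)$ with $e_0=\gamma_x$ and $$g^{-1}g_x=\begin{pmatrix}0&-k_1&-k_2\\k_1&0&0\\k_2&0&0\end{pmatrix},\quad g^{-1}g_t=\begin{pmatrix}0&\frac{(k_2)_x}{2}&-\frac{(k_1)_x}{2}\\-\frac{(k_2)_x}{2}&0&\frac{k_1^2+k_2^2}{4}\\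 \frac{(k_1)_x}{2}&-\frac{k_1^2+k_2^2}{4}&0\end{pmatrix};$$ then $q=\frac12(k_1+ik_2)$ solves the NLS. For a solution $q$ of the NLS put $u=\begin{pmatrix}0&q\\-\bar q&0\end{pmatrix}$, $Q_{-1}(u)=\frac{i}{2}\begin{pmatrix}-|q|^2&q_x\\ \bar q_x&|q|^2\end{pmatrix}$. A frame of $q$ is an invertible-matrix-valued solution $E(x,t,\lambda)$, smooth in $(x,t)$ and holomorphic in $\lambda$ (away from a possibly empty, conjugation-invariant finite set of non-real $\lambda$), of $E^{-1}E_x=a\lambda+u$, $E^{-1}E_t=a\lambda^2+u\lambda+Q_{-1}(u)$ with $E(x,t,\bar\lambda)^*E(x,t,\lambda)=I_2$. A Hermitian projection satisfies $\pi^*=\pi$, $\pi^2=\pi$; $f_{\alpha,\pi}(\lambda)=I_2+\frac{\alpha-\bar\alpha}{\lambda-\alpha}(I_2-\pi)$. *)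

(* Defs.v *)
From HB Require Import structures.
From mathcomp Require Import all_boot all_order all_algebra.
From mathcomp Require Import complex.
From mathcomp Require Import all_classical all_reals all_analysis.
Set Implicit Arguments.
Unset Strict Implicit.
Unset Printing Implicit Defensive.
Import Order.TTheory GRing.Theory Num.Theory.
Import numFieldNormedType.Exports.
Local Open Scope ring_scope.
Local Open Scope classical_set_scope.
Local Open Scope sesquilinear_scope.

Definition mx_of_rows (T : nmodType) m n (rows : seq (seq T)) : 'M[T]_(m, n) :=
  \matrix_(i, j) (nth [::] rows i)`_j.

Section Calculus.
Context {R : realType}.

Section RealValued.
Context {V : normedModType R}.

Definition pdx (f : R -> R -> V) (x t : R) : V := (f ^~ t)^`() x.
Definition pdt (f : R -> R -> V) (x t : R) : V := (f x)^`() t.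

Fixpoint Ck (k : nat) (f : R -> R -> V) : Prop :=
  continuous (fun p : R * R => f p.1 p.2) /\
  if k is k'.+1 then
    [/\ forall x t, derivable (f ^~ t) x 1,
        forall x t, derivable (f x) t 1,
        Ck k' (pdx f) & Ck k' (pdt f)]
  else True.

Definition smooth (f : R -> R -> V) : Prop := forall k, Ck k f.

Definition smooth1 (f : R -> V) : Prop :=
  forall n s, derivable (f^`(n)) s 1.

End RealValued.

(* [R[i]] carries no normed [R]-module structure in the library, so derivatives
   of complex-valued functions of real variables are taken on real and
   imaginary parts, and those of complex matrices entrywise. *)
Section ComplexValued.

Definition cpdx (f : R -> R -> R[i]) (x t : R) : R[i] :=
  (pdx (fun x t => complex.Re (f x t)) x t +i* pdx (fun x t => complex.Im (f x t)) x t)%C.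
Definition cpdt (f : R -> R -> R[i]) (x t : R) : R[i] :=
  (pdt (fun x t => complex.Re (f x t)) x t +i* pdt (fun x t => complex.Im (f x t)) x t)%C.
Definition csmooth (f : R -> R -> R[i]) : Prop :=
  smooth (fun x t => complex.Re (f x t)) /\ smooth (fun x t => complex.Im (f x t)).

Context {m n : nat}.
Definition mpdx (F : R -> R -> 'M[R[i]]_(m, n)) (x t : R) : 'M[R[i]]_(m, n) :=
  \matrix_(i, j) cpdx (fun x t => F x t i j) x t.
Definition mpdt (F : R -> R -> 'M[R[i]]_(m, n)) (x t : R) : 'M[R[i]]_(m, n) :=
  \matrix_(i, j) cpdt (fun x t => F x t i j) x t.
Definition msmooth (F : R -> R -> 'M[R[i]]_(m, n)) : Prop :=
  forall i j, csmooth (fun x t => F x t i j).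

End ComplexValued.
End Calculus.

(* Differentiability over the scalar field [K] itself; for [K = R[i]] this is
   complex differentiability. *)
Definition derivable_at (K : numFieldType) (f : K -> K) (l : K) : Prop :=
  derivable (f : K^o -> K^o) l 1.

Section Euclidean.
Context {R : realType}.
Implicit Types u v : 'cV[R]_3.

Definition dot u v : R := \sum_i u i 0 * v i 0.

(* The library norm on matrices is the sup norm. *)
Definition enorm u : R := Num.sqrt (dot u u).

(* Indices in ['I_3] are added modulo 3. *)
Definition cross u v : 'cV[R]_3 :=
  \col_(i < 3) (u (i + 1) 0 * v (i + 2%:R) 0 - u (i + 2%:R) 0 * v (i + 1) 0).

Definition SO3 (g : 'M[R]_3) : Prop := g^T *m g = 1%:M /\ \det g = 1.

Definition curve_flow (gamma : R -> R -> 'cV[R]_3) : Prop :=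
  smooth gamma /\
  forall x t, pdt gamma x t =
    2^-1 *: cross (pdx gamma x t) (pdx (pdx gamma) x t).

Definition arc_length (c : R -> 'cV[R]_3) : Prop :=
  forall s, enorm (c^`()%classic s) = 1.

(* The frame (e_0, e_1, e_2) is the matrix with columns e_0, e_1, e_2. *)
Definition princ_curv (i : 'I_3) (g : R -> 'M[R]_3) (s : R) : R :=
  dot ((fun r => col 0 (g r))^`()%classic s) (col i (g s)).

Definition p_frame (c : R -> 'cV[R]_3) (g : R -> 'M[R]_3) : Prop :=
  [/\ smooth1 c /\ arc_length c,
      smooth1 g,
      forall s, SO3 (g s),
      forall s, col 0 (g s) = c^`() s &
      (* the normal component of (e_i)_x vanishes *)
      forall (i : 'I_3) s, i != 0 ->
        let de := (fun r => col i (g r))^`() s in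
        de - dot de (col 0 (g s)) *: col 0 (g s) = 0].

Definition adapted_p_frame (gamma : R -> R -> 'cV[R]_3) (g : R -> R -> 'M[R]_3)
    (k1 k2 : R -> R -> R) : Prop :=
  [/\ smooth g /\ (forall x t, SO3 (g x t)),
      forall x t, col 0 (g x t) = pdx gamma x t,
      forall x t, k1 x t = princ_curv 1 (g ^~ t) x
               /\ k2 x t = princ_curv 2%:R (g ^~ t) x,
      forall x t, invmx (g x t) *m pdx g x t = mx_of_rows 3 3
        [:: [:: 0;        - k1 x t; - k2 x t];
            [:: k1 x t;   0;        0       ];
            [:: k2 x t;   0;        0       ]] &
      forall x t, let w := (k1 x t ^+ 2 + k2 x t ^+ 2) / 4%:R in
        invmx (g x t) *m pdt g x t = mx_of_rows 3 3
        [:: [:: 0;                   pdx k2 x t / 2; - (pdx k1 x t / 2)];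
            [:: - (pdx k2 x t / 2);  0;              w                 ];
            [:: pdx k1 x t / 2;      - w;            0                 ]]].

End Euclidean.

Section Su2.
Context {R : realType}.
Notation C := R[i].

Definition su_a : 'M[C]_2 := mx_of_rows 2 2 [:: [:: ('i)%C; 0]; [:: 0; - ('i)%C]].
Definition su_b : 'M[C]_2 := mx_of_rows 2 2 [:: [:: 0; 1]; [:: -1; 0]].
Definition su_c : 'M[C]_2 := mx_of_rows 2 2 [:: [:: 0; ('i)%C]; [:: ('i)%C; 0]].

Definition su2_of (v : 'cV[R]_3) : 'M[C]_2 :=
  (v 0 0)%:C%C *: su_a + (v 1 0)%:C%C *: su_b + (v 2%:R 0)%:C%C *: su_c.

(* Inverse of [su2_of] on su(2), where X = [[i x, y + i z]; [- y + i z, - i x]];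
   meaningless on other matrices. *)
Definition R3_of (X : 'M[C]_2) : 'cV[R]_3 :=
  mx_of_rows 3 1 [:: [:: complex.Im (X 0 0)]; [:: complex.Re (X 0 1)]; [:: complex.Im (X 0 1)]].

Lemma su2_ofK : cancel su2_of R3_of.
Proof.
move=> v; apply/matrixP => i j.
rewrite (ord1 j) /R3_of /su2_of /su_a /su_b /su_c /mx_of_rows !mxE.
by case: i => -[|[|[|//]]] li /=;
   rewrite !(mulr0, mulr1, mul0r, mul1r, oppr0, addr0, add0r); congr (v _ _);
   apply: val_inj.
Qed.

Definition delta (j : 'I_3) : 'M[C]_2 := nth 0 [:: su_a; - su_c; su_b] j.

Definition Ad_delta (phi : 'M[C]_2) : 'M[R]_3 :=
  \matrix_(i, j) R3_of (phi *m delta j *m invmx phi) i 0.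

Definition SU2 (phi : 'M[C]_2) : Prop := phi \is unitarymx /\ \det phi = 1.

Definition NLS (q : R -> R -> C) : Prop :=
  csmooth q /\
  forall x t, cpdt q x t =
    ('i)%C / 2 * (cpdx (cpdx q) x t + 2 * `|q x t| ^+ 2 * q x t).

Definition lax_u (q : R -> R -> C) (x t : R) : 'M[C]_2 :=
  mx_of_rows 2 2 [:: [:: 0; q x t]; [:: - (q x t)^*; 0]].

Definition lax_Q (q : R -> R -> C) (x t : R) : 'M[C]_2 :=
  (('i)%C / 2) *: mx_of_rows 2 2
    [:: [:: - `|q x t| ^+ 2;  cpdx q x t     ];
        [:: (cpdx q x t)^*;   `|q x t| ^+ 2  ]].

(* Frame defined away from the exceptional set [S]; [S = [::]] is the case of
   a frame entire in the spectral parameter. *)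
Definition frame_off (S : seq C) (q : R -> R -> C)
    (E : R -> R -> C -> 'M[C]_2) : Prop :=
  forall l : C, l \notin S ->
  [/\ msmooth (fun x t => E x t l),
      forall x t i j, derivable_at (fun z => E x t z i j) l,
      forall x t, E x t l \in unitmx /\ (E x t l^*)^t* *m E x t l = 1%:M,
      forall x t, invmx (E x t l) *m mpdx (fun x t => E x t l) x t =
        l *: su_a + lax_u q x t &
      forall x t, invmx (E x t l) *m mpdt (fun x t => E x t l) x t =
        l ^+ 2 *: su_a + l *: lax_u q x t + lax_Q q x t].

Definition is_frame (q : R -> R -> C) (E : R -> R -> C -> 'M[C]_2) : Prop :=
  exists S : seq C,
  [/\ forall l, l \in S -> l^* \in S,
      forall l, l \in S -> l \isn't Num.real &
      frame_off S q E].

Definition herm_proj_onto (y : 'cV[C]_2) (p : 'M[C]_2) : Prop :=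
  [/\ p^t* = p,
      p *m p = p &
      forall v : 'cV[C]_2,
        (exists w : 'cV[C]_2, v = p *m w) <-> (exists c : C, v = c *: y)].

Definition simple_factor (alpha : C) (p : 'M[C]_2) (l : C) : 'M[C]_2 :=
  1%:M + ((alpha - alpha^*) / (l - alpha)) *: (1%:M - p).

End Su2.

(* Main.v *)
Require Import Defs.
From HB Require Import structures.
From mathcomp Require Import all_boot all_order all_algebra.
From mathcomp Require Import complex.
From mathcomp Require Import all_classical all_reals all_analysis.
From mathcomp Require Import ring lra.
Set Implicit Arguments.
Unset Strict Implicit.
Unset Printing Implicit Defensive.
Import Order.TTheory GRing.Theory Num.Theory.
Import numFieldNormedType.Exports.
Local Open Scope ring_scope.
Local Open Scope classical_set_scope.
Local Open Scope sesquilinear_scope.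

(* Write [h = p + (l - alpha) / (l - conj alpha) (1 - p)] for the inverse of the
   simple factor.  Differentiating [p y = y] and [p^2 = p] shows that [p] solves
   a first order system with coefficients in [p], [alpha] and the Lax matrices
   of [q]; with [p^2 = p] this gives the gauge identities
     [A(l) h + h_x = h A~(l)],  [B(l) h + h_t = h B~(l)],
   where [A~], [B~] are the Lax matrices of the dressed potential, so [E h] is a
   frame of it.  At [l = 0] a frame [phi] of a potential [u] carries all the
   geometry: [Ad phi] applied to [delta] is the p-frame, the equality of mixed
   derivatives of [phi] is the NLS, and a curve with
   [gamma_x = phi a phi^-1], [gamma_t = phi u phi^-1] solves the curve flow.
   The given [g] is [Ad phi] because both solve the same linear system with
   skew coefficients, and the formula for the new curve is the integral of
   these two relations for [phi h(0)]. *)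

(** * Smooth functions of two real variables *)

(** The correction term comes from Sym's formula. For a frame [E] the matrix [E_l E^-1] at [l = 0]
    has x-derivative [phi a phi^-1] and t-derivative [phi u phi^-1], because [A(l)] and [B(l)] have
    l-derivatives [a] and [u] at 0. So it is the curve up to a constant. Replacing [E] by [E h] adds
    [phi h_l h^-1 phi^-1], and [h_l h^-1 = (alpha - conj alpha) / |alpha|^2 (1 - p)] at [l = 0]; its
    trace-free part is the stated multiple of [p - 1/2]. The formula serves only as a guide: for the
    curve nothing is differentiated in [l], and the x- and t-derivatives of the new curve are
    checked by matrix identities. These, like the gauge identities, become polynomial in matrix
    entries once conjugates are treated as independent letters; the only relations used are
    [i^2 = -1] and the scalar form of [p^2 = p]. *)

Section Ck.
Context {R : realType}.
Implicit Types f g : R -> R -> R.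

Lemma CkW (V : normedModType R) k (f : R -> R -> V) : Ck k.+1 f -> Ck k f.
Proof.
elim: k f => [|k IH] f /=; first by case.
case=> cf [dx dt cx ct]; split; first exact: cf.
by split; [exact: dx | exact: dt | exact: IH cx | exact: IH ct].
Qed.

Lemma smooth_pdx (V : normedModType R) (f : R -> R -> V) :
  smooth f -> smooth (pdx f).
Proof. by move=> sf k; case: (sf k.+1) => _ []. Qed.

Lemma smooth_pdt (V : normedModType R) (f : R -> R -> V) :
  smooth f -> smooth (pdt f).
Proof. by move=> sf k; case: (sf k.+1) => _ []. Qed.

Lemma smooth_derivable_x (V : normedModType R) (f : R -> R -> V) x t :
  smooth f -> derivable (f ^~ t) x 1.
Proof. by move=> sf; case: (sf 1%N) => _ []. Qed.

Lemma smooth_derivable_t (V : normedModType R) (f : R -> R -> V) x t :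
  smooth f -> derivable (f x) t 1.
Proof. by move=> sf; case: (sf 1%N) => _ []. Qed.

Lemma Ck_const (V : normedModType R) k (c : V) : Ck k (fun _ _ : R => c).
Proof.
elim: k c => [|k IH] c /=; first by split=> //; exact: cst_continuous.
have d0 : pdx (fun _ _ : R => c) = fun _ _ => 0.
  by apply/funext => x; apply/funext => t; rewrite /pdx derive1_cst.
have d1 : pdt (fun _ _ : R => c) = fun _ _ => 0.
  by apply/funext => x; apply/funext => t; rewrite /pdt derive1_cst.
rewrite d0 d1; split; first exact: cst_continuous.
by split=> //; exact: IH.
Qed.

Lemma Ck_add k f g : Ck k f -> Ck k g -> Ck k (fun x t => f x t + g x t).
Proof.
elim: k f g => [|k IH] f g /=.
  by case=> cf _ [cg _]; split=> // p; apply: cvgD; [exact: cf|exact: cg].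
case=> cf [dfx dft Cfx Cft] [cg [dgx dgt Cgx Cgt]].
have -> : pdx (fun x t => f x t + g x t) = fun x t => pdx f x t + pdx g x t.
  apply/funext => x; apply/funext => t; rewrite /pdx !derive1E.
  by rewrite -deriveD.
have -> : pdt (fun x t => f x t + g x t) = fun x t => pdt f x t + pdt g x t.
  apply/funext => x; apply/funext => t; rewrite /pdt !derive1E.
  by rewrite -deriveD.
split; first by move=> p; apply: cvgD; [exact: cf|exact: cg].
split; [ | | exact: IH | exact: IH].
  by move=> x t; exact: (@derivableD _ _ _ (f ^~ t) (g ^~ t)).
by move=> x t; exact: (@derivableD _ _ _ (f x) (g x)).
Qed.

Lemma Ck_mul k f g : Ck k f -> Ck k g -> Ck k (fun x t => f x t * g x t).
Proof.
elim: k f g => [|k IH] f g /=.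
  by case=> cf _ [cg _]; split=> // p; apply: cvgM; [exact: cf|exact: cg].
(* The product rule leaves one factor undifferentiated in each term, so both factors are also needed
   in the lower class [Ck k]. *)
move=> Cf Cg; have Cf' := CkW Cf; have Cg' := CkW Cg.
case: Cf => cf [dfx dft Cfx Cft]; case: Cg => cg [dgx dgt Cgx Cgt].
have -> : pdx (fun x t => f x t * g x t) =
    fun x t => f x t * pdx g x t + g x t * pdx f x t.
  apply/funext => x; apply/funext => t; rewrite /pdx !derive1E.
  exact: (@deriveM _ _ (f ^~ t) (g ^~ t)).
have -> : pdt (fun x t => f x t * g x t) =
    fun x t => f x t * pdt g x t + g x t * pdt f x t.
  apply/funext => x; apply/funext => t; rewrite /pdt !derive1E.
  exact: (@deriveM _ _ (f x) (g x)).
split; first by move=> p; apply: cvgM; [exact: cf|exact: cg].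
split.
- by move=> x t; exact: (@derivableM _ _ (f ^~ t) (g ^~ t)).
- by move=> x t; exact: (@derivableM _ _ (f x) (g x)).
- by apply: Ck_add; exact: IH.
- by apply: Ck_add; exact: IH.
Qed.

Lemma Ck_inv k f : (forall x t, f x t != 0) -> Ck k f ->
  Ck k (fun x t => (f x t)^-1).
Proof.
move=> f0; elim: k f f0 => [|k IH] f f0 /=.
  by case=> cf _; split=> // p; apply: cvgV; [exact: f0|exact: cf].
move=> Cf; have Cf' := IH _ f0 (CkW Cf).
case: Cf => cf [dfx dft Cfx Cft].
(* The derivative is written with [f^-1] itself, whose class [k] is the induction hypothesis, so
   that [Ck_mul] finishes. *)
have -> : pdx (fun x t => (f x t)^-1) =
    fun x t => (-1 * ((f x t)^-1 * (f x t)^-1)) * pdx f x t.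
  apply/funext => x; apply/funext => t; rewrite /pdx !derive1E.
  rewrite (@deriveV _ _ (f ^~ t)) //.
  by rewrite mulN1r -invfM -expr2.
have -> : pdt (fun x t => (f x t)^-1) =
    fun x t => (-1 * ((f x t)^-1 * (f x t)^-1)) * pdt f x t.
  apply/funext => x; apply/funext => t; rewrite /pdt !derive1E.
  rewrite (@deriveV _ _ (f x)) //.
  by rewrite mulN1r -invfM -expr2.
split; first by move=> p; apply: cvgV; [exact: f0|exact: cf].
split.
- by move=> x t; exact: (@derivableV _ _ (f ^~ t)).
- by move=> x t; exact: (@derivableV _ _ (f x)).
- by do ?apply: Ck_mul => //; exact: Ck_const.
- by do ?apply: Ck_mul => //; exact: Ck_const.
Qed.

Lemma smooth_const (V : normedModType R) (c : V) : smooth (fun _ _ : R => c).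
Proof. by move=> k; exact: Ck_const. Qed.

Lemma smoothD f g : smooth f -> smooth g -> smooth (fun x t => f x t + g x t).
Proof. by move=> sf sg k; apply: Ck_add. Qed.

Lemma smoothM f g : smooth f -> smooth g -> smooth (fun x t => f x t * g x t).
Proof. by move=> sf sg k; apply: Ck_mul. Qed.

Lemma smoothN f : smooth f -> smooth (fun x t => - f x t).
Proof.
move=> sf; have -> : (fun x t => - f x t) = fun x t => -1 * f x t.
  by apply/funext => x; apply/funext => t; rewrite mulN1r.
exact: smoothM (smooth_const _) sf.
Qed.

Lemma smoothV f : (forall x t, f x t != 0) -> smooth f ->
  smooth (fun x t => (f x t)^-1).
Proof. by move=> f0 sf k; apply: Ck_inv. Qed.

(** The matrix norm is a maximum over finitely many entries, so continuity, and by induction every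
    derivative, can be tested entrywise. *)
Lemma Ck_mxP k m n (F : R -> R -> 'M[R]_(m.+1, n.+1)) :
  Ck k F <-> forall i j, Ck k (fun x t => F x t i j).
Proof.
have contP (G : R -> R -> 'M[R]_(m.+1, n.+1)) :
    continuous (fun p : R * R => G p.1 p.2) <->
    forall i j, continuous (fun p : R * R => G p.1 p.2 i j).
  split=> [cG i j p|cG p].
    exact: (continuous_comp (cG p) (@coord_continuous _ _ _ i j _)).
  apply/cvgrPdist_le => /= e e0.
  near=> z; rewrite /Num.Def.normr/= mx_normrE (bigmax_le _ (ltW e0))//= => i _.
  rewrite !mxE/=.
  move: i; near: z; apply: filter_forall => /= i.
  exact: ((cvgrPdist_le _ _).1 (cG i.1 i.2 p)).
have pdxE (G : R -> R -> 'M[R]_(m.+1, n.+1)) i j :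
    (forall x t, derivable (G ^~ t) x 1) ->
    (fun x t => pdx G x t i j) = pdx (fun x t => G x t i j).
  move=> dG; apply/funext => x; apply/funext => t.
  by rewrite /pdx !derive1E derive_mx // mxE.
have pdtE (G : R -> R -> 'M[R]_(m.+1, n.+1)) i j :
    (forall x t, derivable (G x) t 1) ->
    (fun x t => pdt G x t i j) = pdt (fun x t => G x t i j).
  move=> dG; apply/funext => x; apply/funext => t.
  by rewrite /pdt !derive1E derive_mx // mxE.
elim: k F => [|k IH] F /=.
  split=> [[/contP cF _] i j|cF]; first by split=> //; exact: cF.
  by split=> //; apply/contP => i j; case: (cF i j).
split=> [[/contP cF [dx dt Cx Ct]] i j|CF].
  split; first exact: cF.
  split.
  - by move=> x t; exact: (derivable_mxP _ _ _).1 (dx x t) i j.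
  - by move=> x t; exact: (derivable_mxP _ _ _).1 (dt x t) i j.
  - rewrite -pdxE; [exact: (IH _).1 Cx i j | exact: dx].
  - rewrite -pdtE; [exact: (IH _).1 Ct i j | exact: dt].
have dx x t : derivable (F ^~ t) x 1.
  by apply/derivable_mxP => i j; case: (CF i j) => _ [].
have dt x t : derivable (F x) t 1.
  by apply/derivable_mxP => i j; case: (CF i j) => _ [].
split; first by apply/contP => i j; case: (CF i j).
split; [exact: dx | exact: dt | |].
  by apply/IH => i j; rewrite pdxE; [case: (CF i j) => _ [] | exact: dx].
by apply/IH => i j; rewrite pdtE; [case: (CF i j) => _ [] | exact: dt].
Unshelve. all: by end_near. Qed.

Lemma smooth_mxP m n (F : R -> R -> 'M[R]_(m.+1, n.+1)) :
  smooth F <-> forall i j, smooth (fun x t => F x t i j).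
Proof.
split=> [sF i j k|sF k]; first exact/(Ck_mxP k F).1.
by apply/(Ck_mxP k F) => i j; exact: sF.
Qed.

Lemma smooth_slice (V : normedModType R) (f : R -> R -> V) t :
  smooth f -> smooth1 (f ^~ t).
Proof.
move=> sf n s.
elim: n f sf => [|n IH] f sf.
  by rewrite derive1n0; exact: smooth_derivable_x.
rewrite derive1Sn.
have -> : (f ^~ t)^`() = pdx f ^~ t by [].
exact: IH (smooth_pdx sf).
Qed.

(** Two uses of the mean value theorem: in x for [s |-> f s (t + h) - f s t], which yields [xi], and
    in t for [pdx f xi], which yields [eta]. *)
Lemma mixed_difference f (x t h : R) : 0 < h ->
  (forall x t, derivable (f ^~ t) x 1) ->
  (forall x t, derivable (pdx f x) t 1) ->
  exists xi eta, [/\ x < xi < x + h, t < eta < t + h &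
    f (x + h) (t + h) - f (x + h) t - (f x (t + h) - f x t) =
    pdt (pdx f) xi eta * h * h].
Proof.
move=> h0 dx dxt.
have xh : x < x + h by rewrite ltrDl.
have th : t < t + h by rewrite ltrDl.
have Dx (s : R) : is_derive s 1 (fun s => f s (t + h) - f s t)
    (pdx f s (t + h) - pdx f s t).
  apply: (@is_deriveB _ _ _ (f ^~ (t + h)) (f ^~ t)).
    by rewrite /pdx derive1E; exact: derivableP.
  by rewrite /pdx derive1E; exact: derivableP.
have [|xi] := MVT xh (fun s _ => Dx s).
  by apply: derivable_within_continuous => s _; case: (Dx s).
rewrite in_itv /= => xiI Exi.
have Dt (s : R) : is_derive s 1 (pdx f xi) (pdt (pdx f) xi s).
  by rewrite /pdt derive1E; exact: derivableP.
have [|eta] := MVT th (fun s _ => Dt s).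
  by apply: derivable_within_continuous => s _; case: (Dt s).
rewrite in_itv /= => etaI Eeta.
exists xi, eta; split; [exact: xiI | exact: etaI |].
have addK (y : R) : y + h - y = h by rewrite addrAC subrr add0r.
by rewrite addK in Exi; rewrite addK in Eeta; rewrite Exi Eeta.
Qed.

Lemma dist_lt_half_absurd (a b c : R) :
  `|a - c| < `|a - b| / 2 -> `|b - c| < `|a - b| / 2 -> False.
Proof. by move=> L1 L2; have := ler_distD c a b; rewrite (distrC c b); lra. Qed.

(* Mixed differences over small squares are values of both mixed derivatives
   at points of the square. *)
Lemma schwarz f : Ck 2 f -> pdx (pdt f) = pdt (pdx f).
Proof.
case=> cf [dx dt [cx [dxx dxt _ [cxt _]]] [ct [dtx dtt [ctx _] _]]].
apply/funext => x; apply/funext => t; apply/eqP/negP => /negP neq.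
set a := pdx (pdt f) x t in neq; set b := pdt (pdx f) x t in neq.
have e0 : 0 < `|a - b| / 2 by rewrite divr_gt0 // normr_gt0 subr_eq0.
have /cvgrPdist_lt/(_ _ e0)/nbhs_ballP[d1 /= d10 B1] := ctx (x, t).
have /cvgrPdist_lt/(_ _ e0)/nbhs_ballP[d2 /= d20 B2] := cxt (x, t).
pose h := Num.min d1 d2.
have h0 : 0 < h by rewrite lt_min d10 d20.
have [xi [eta [xiI etaI E1]]] := @mixed_difference f x t h h0 dx dxt.
(* Applied to the transposed function, the lemma expresses the same second difference through the
   other mixed derivative. *)
have [eta' [xi' [etaI' xiI' E2]]] :=
  @mixed_difference (fun t x => f x t) t x h h0 (fun t x => dt x t)
    (fun t x => dtx x t).
have near_ball (y z : R) : y < z < y + h -> `|y - z| < h.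
  by move=> /andP[yz zy]; rewrite ltr0_norm ?subr_lt0 // opprB ltrBlDl.
have swap (a' b' : R) :
    pdt (pdx (fun t x => f x t)) b' a' = pdx (pdt f) a' b' by rewrite /pdt /pdx.
rewrite swap in E2.
have sub4 (a' b' c' d' : R) : a' - b' - (c' - d') = a' - c' - (b' - d').
  by rewrite !opprB addrACA [- b' + _]addrC addrACA [d' - b']addrC.
have EE : pdt (pdx f) xi eta = pdx (pdt f) xi' eta'.
  apply: (mulIf (lt0r_neq0 h0)); apply: (mulIf (lt0r_neq0 h0)).
  exact: etrans (esym E1) (etrans (sub4 _ _ _ _) E2).
have L1 : `|a - pdx (pdt f) xi' eta'| < `|a - b| / 2.
  apply: (B1 (xi', eta')); split=> /=.
    by apply: lt_le_trans (near_ball _ _ xiI') _; rewrite /h ge_min lexx.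
  by apply: lt_le_trans (near_ball _ _ etaI') _; rewrite /h ge_min lexx.
have L2 : `|b - pdt (pdx f) xi eta| < `|a - b| / 2.
  apply: (B2 (xi, eta)); split=> /=.
    by apply: lt_le_trans (near_ball _ _ xiI) _; rewrite /h ge_min lexx orbT.
  by apply: lt_le_trans (near_ball _ _ etaI) _; rewrite /h ge_min lexx orbT.
by rewrite EE in L2; exact: dist_lt_half_absurd L1 L2.
Qed.
End Ck.

(** * Derivatives of complex matrices *)

Section ComplexDerivative.
Context {R : realType}.
Notation C := R[i].
Implicit Types (F G : R -> C) (s : R).

Lemma conjCE (z : C) : z^* = (complex.Re z -i* complex.Im z)%C.
Proof. by case: z. Qed.

Lemma ReM (a b : C) : complex.Re (a * b) =
  complex.Re a * complex.Re b - complex.Im a * complex.Im b.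
Proof. by case: a; case: b. Qed.

Lemma ImM (a b : C) : complex.Im (a * b) =
  complex.Re a * complex.Im b + complex.Im a * complex.Re b.
Proof. by case: a; case: b. Qed.

Lemma ReD (a b : C) : complex.Re (a + b) = complex.Re a + complex.Re b.
Proof. by case: a; case: b. Qed.

Lemma ImD (a b : C) : complex.Im (a + b) = complex.Im a + complex.Im b.
Proof. by case: a; case: b. Qed.

Lemma is_derivM (f g : R -> R) s (df dg : R) :
  is_derive s 1 f df -> is_derive s 1 g dg ->
  is_derive s 1 (fun r => f r * g r) (df * g s + f s * dg).
Proof.
move=> Df Dg; apply: is_derive_eq (is_deriveM Df Dg) _.
by rewrite addrC; congr (_ + _); rewrite mulrC.
Qed.

Lemma is_derivD (f g : R -> R) s (df dg : R) :
  is_derive s 1 f df -> is_derive s 1 g dg ->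
  is_derive s 1 (fun r => f r + g r) (df + dg).
Proof. by move=> Df Dg; exact: is_deriveD. Qed.

Lemma is_derivB (f g : R -> R) s (df dg : R) :
  is_derive s 1 f df -> is_derive s 1 g dg ->
  is_derive s 1 (fun r => f r - g r) (df - dg).
Proof. by move=> Df Dg; exact: is_deriveB. Qed.

Lemma is_deriv_sum n (f : 'I_n -> R -> R) s (d : 'I_n -> R) :
  (forall k, is_derive s 1 (f k) (d k)) ->
  is_derive s 1 (fun r => \sum_k f k r) (\sum_k d k).
Proof.
move=> D; have -> : (fun r => \sum_k f k r) = \sum_k f k.
  by apply/funext => r; rewrite fct_sumE.
exact: is_derive_sum.
Qed.

(** A relation rather than a function: existence and value of the derivative are carried together,
    and a computed value is matched with the wanted one by [cderive_eq]. *)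
Definition cderive F s (d : C) : Prop :=
  is_derive s 1 (fun r => complex.Re (F r)) (complex.Re d) /\
  is_derive s 1 (fun r => complex.Im (F r)) (complex.Im d).

Lemma cderive_cst (c : C) s : cderive (fun=> c) s 0.
Proof. by split; exact: is_derive_cst. Qed.

Lemma cderiveD F G s dF dG : cderive F s dF -> cderive G s dG ->
  cderive (fun r => F r + G r) s (dF + dG).
Proof.
move=> [F1 F2] [G1 G2]; split.
  rewrite ReD; have -> : (fun r => complex.Re (F r + G r)) =
      fun r => complex.Re (F r) + complex.Re (G r).
    by apply/funext => r; rewrite ReD.
  exact: is_derivD.
rewrite ImD; have -> : (fun r => complex.Im (F r + G r)) =
    fun r => complex.Im (F r) + complex.Im (G r).
  by apply/funext => r; rewrite ImD.
exact: is_derivD.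
Qed.

Lemma cderiveM F G s dF dG : cderive F s dF -> cderive G s dG ->
  cderive (fun r => F r * G r) s (dF * G s + F s * dG).
Proof.
move=> [F1 F2] [G1 G2]; split.
  have -> : (fun r => complex.Re (F r * G r)) = fun r =>
      complex.Re (F r) * complex.Re (G r) - complex.Im (F r) * complex.Im (G r).
    by apply/funext => r; rewrite ReM.
  apply: is_derive_eq (is_derivB (is_derivM F1 G1) (is_derivM F2 G2)) _.
  by rewrite ReD !ReM opprD addrACA.
have -> : (fun r => complex.Im (F r * G r)) = fun r =>
    complex.Re (F r) * complex.Im (G r) + complex.Im (F r) * complex.Re (G r).
  by apply/funext => r; rewrite ImM.
apply: is_derive_eq (is_derivD (is_derivM F1 G2) (is_derivM F2 G1)) _.
by rewrite ImD !ImM addrACA.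
Qed.

Lemma cderiveJ F s dF : cderive F s dF -> cderive (fun r => (F r)^*) s dF^*.
Proof.
move=> [F1 F2]; split.
  rewrite conjCE /=; have -> : (fun r => complex.Re (F r)^*) =
      fun r => complex.Re (F r) by apply/funext => r; rewrite conjCE.
  exact: F1.
rewrite conjCE /=; have -> : (fun r => complex.Im (F r)^*) =
    fun r => - complex.Im (F r) by apply/funext => r; rewrite conjCE.
exact: is_deriveN.
Qed.

Lemma cderive_eq F s d d' : cderive F s d -> d = d' -> cderive F s d'.
Proof. by move=> D <-. Qed.

Lemma cderive_sum n (F : 'I_n -> R -> C) s (d : 'I_n -> C) :
  (forall k, cderive (F k) s (d k)) ->
  cderive (fun r => \sum_k F k r) s (\sum_k d k).
Proof.
elim: n F d => [|n IH] F d D.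
  rewrite big_ord0; have -> : (fun r => \sum_k F k r) = fun=> 0.
    by apply/funext => r; rewrite big_ord0.
  exact: cderive_cst.
rewrite big_ord_recr; have -> : (fun r => \sum_k F k r) = fun r =>
    \sum_(k < n) F (widen_ord (leqnSn n) k) r + F ord_max r.
  by apply/funext => r; rewrite big_ord_recr.
by apply: cderiveD; [apply: IH => k; exact: D | exact: D].
Qed.

Definition mderive m n (F : R -> 'M[C]_(m, n)) s (D : 'M[C]_(m, n)) : Prop :=
  forall i j, cderive (fun r => F r i j) s (D i j).

Lemma mderive_cst m n (A : 'M[C]_(m, n)) s : mderive (fun=> A) s 0.
Proof. by move=> i j; rewrite mxE; exact: cderive_cst. Qed.

Lemma mderiveD m n (F G : R -> 'M[C]_(m, n)) s dF dG :
  mderive F s dF -> mderive G s dG -> mderive (fun r => F r + G r) s (dF + dG).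
Proof.
move=> DF DG i j; rewrite mxE; have -> : (fun r => (F r + G r) i j) =
    fun r => F r i j + G r i j by apply/funext => r; rewrite mxE.
by apply: cderiveD; [exact: DF | exact: DG].
Qed.

Lemma mderiveM m n p (F : R -> 'M[C]_(m, n)) (G : R -> 'M[C]_(n, p)) s dF dG :
  mderive F s dF -> mderive G s dG ->
  mderive (fun r => F r *m G r) s (dF *m G s + F s *m dG).
Proof.
move=> DF DG i j; have -> : (fun r => (F r *m G r) i j) =
    fun r => \sum_k F r i k * G r k j by apply/funext => r; rewrite mxE.
rewrite !mxE -big_split /=; apply: cderive_sum => k.
by apply: cderiveM; [exact: DF | exact: DG].
Qed.

Lemma mderiveZ m n (f : R -> C) (F : R -> 'M[C]_(m, n)) s df dF :
  cderive f s df -> mderive F s dF ->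
  mderive (fun r => f r *: F r) s (df *: F s + f s *: dF).
Proof.
move=> Df DF i j; have -> : (fun r => (f r *: F r) i j) =
    fun r => f r * F r i j by apply/funext => r; rewrite mxE.
by rewrite !mxE; apply: cderiveM; [exact: Df | exact: DF].
Qed.

Lemma mderive_eq m n (F : R -> 'M[C]_(m, n)) s D D' :
  mderive F s D -> D = D' -> mderive F s D'.
Proof. by move=> H <-. Qed.

Lemma mderiveZc m n (c : C) (F : R -> 'M[C]_(m, n)) s dF :
  mderive F s dF -> mderive (fun r => c *: F r) s (c *: dF).
Proof.
move=> DF; apply: mderive_eq (mderiveZ (cderive_cst c s) DF) _.
by rewrite scale0r add0r.
Qed.

Lemma mderiveB m n (F G : R -> 'M[C]_(m, n)) s dF dG :
  mderive F s dF -> mderive G s dG -> mderive (fun r => F r - G r) s (dF - dG).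
Proof.
move=> DF DG; rewrite -scaleN1r; have -> : (fun r => F r - G r) =
    fun r => F r + -1 *: G r by apply/funext => r; rewrite scaleN1r.
by apply: mderiveD => //; exact: mderiveZc.
Qed.

Lemma mderiveJ m n (F : R -> 'M[C]_(m, n)) s dF :
  mderive F s dF -> mderive (fun r => (F r)^t*) s (dF^t*).
Proof.
move=> DF i j; have -> : (fun r => (F r)^t* i j) = fun r => (F r j i)^*.
  by apply/funext => r; rewrite !mxE.
by rewrite !mxE; exact: cderiveJ.
Qed.

Lemma mderive_congr m n (F G : R -> 'M[C]_(m, n)) s D :
  (forall r, F r = G r) -> mderive F s D -> mderive G s D.
Proof. by move=> /funext ->. Qed.

Lemma is_deriv_uniq (f : R -> R) s a b :
  is_derive s 1 f a -> is_derive s 1 f b -> a = b.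
Proof. by move=> [_ <-] [_ <-]. Qed.

(** This turns an identity between functions, such as [p^2 = p], into an identity between
    derivatives: one function is differentiated in two ways. *)
Lemma mderive_uniq m n (F : R -> 'M[C]_(m, n)) s D D' :
  mderive F s D -> mderive F s D' -> D = D'.
Proof.
move=> H H'; apply/matrixP => i j.
have [[r1 i1] [r2 i2]] := (H i j, H' i j).
move: (is_deriv_uniq r1 r2) (is_deriv_uniq i1 i2).
by case: (D i j) (D' i j) => a b [a' b'] /= -> ->.
Qed.

End ComplexDerivative.

(** * Smooth complex matrix functions and their mixed derivatives *)

Section ComplexSmooth.
Context {R : realType}.
Notation C := R[i].
Implicit Types F G : R -> R -> C.

Lemma csmooth_cderive_x F x t :
  csmooth F -> cderive (F ^~ t) x (cpdx F x t).
Proof.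
move=> [F1 F2]; split; rewrite /cpdx /= /pdx derive1E; apply: derivableP.
  exact: (@smooth_derivable_x _ _ (fun x t => complex.Re (F x t))).
exact: (@smooth_derivable_x _ _ (fun x t => complex.Im (F x t))).
Qed.

Lemma csmooth_cderive_t F x t :
  csmooth F -> cderive (F x) t (cpdt F x t).
Proof.
move=> [F1 F2]; split; rewrite /cpdt /= /pdt derive1E; apply: derivableP.
  exact: (@smooth_derivable_t _ _ (fun x t => complex.Re (F x t))).
exact: (@smooth_derivable_t _ _ (fun x t => complex.Im (F x t))).
Qed.

Lemma msmooth_mderive_x m n (F : R -> R -> 'M[C]_(m, n)) x t :
  msmooth F -> mderive (F ^~ t) x (mpdx F x t).
Proof. by move=> sF i j; rewrite mxE; exact: csmooth_cderive_x. Qed.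

Lemma msmooth_mderive_t m n (F : R -> R -> 'M[C]_(m, n)) x t :
  msmooth F -> mderive (F x) t (mpdt F x t).
Proof. by move=> sF i j; rewrite mxE; exact: csmooth_cderive_t. Qed.

Lemma cderive_cpdx F x t d : cderive (F ^~ t) x d -> cpdx F x t = d.
Proof.
move=> [F1 F2]; rewrite /cpdx /pdx !derive1E.
have -> := @derive_val _ _ _ _ _ _ _ F1.
by have -> := @derive_val _ _ _ _ _ _ _ F2; case: d {F1 F2}.
Qed.

Lemma cderive_cpdt F x t d : cderive (F x) t d -> cpdt F x t = d.
Proof.
move=> [F1 F2]; rewrite /cpdt /pdt !derive1E.
have -> := @derive_val _ _ _ _ _ _ _ F1.
by have -> := @derive_val _ _ _ _ _ _ _ F2; case: d {F1 F2}.
Qed.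

Lemma mderive_mpdx m n (F : R -> R -> 'M[C]_(m, n)) x t D :
  mderive (F ^~ t) x D -> mpdx F x t = D.
Proof.
by move=> H; apply/matrixP => i j; rewrite mxE; exact: cderive_cpdx (H i j).
Qed.

Lemma mderive_mpdt m n (F : R -> R -> 'M[C]_(m, n)) x t D :
  mderive (F x) t D -> mpdt F x t = D.
Proof.
by move=> H; apply/matrixP => i j; rewrite mxE; exact: cderive_cpdt (H i j).
Qed.

Lemma csmooth_eta F :
  csmooth (fun x t => (complex.Re (F x t) +i* complex.Im (F x t))%C) ->
  csmooth F.
Proof. by []. Qed.

Lemma csmooth_const (c : C) : csmooth (fun _ _ : R => c).
Proof. by split; exact: smooth_const. Qed.

Lemma csmoothD F G :
  csmooth F -> csmooth G -> csmooth (fun x t => F x t + G x t).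
Proof.
move=> [F1 F2] [G1 G2]; apply: csmooth_eta; split => /=.
  have -> : (fun x t => complex.Re (F x t + G x t)) =
      fun x t => complex.Re (F x t) + complex.Re (G x t).
    by apply/funext => x; apply/funext => t; rewrite ReD.
  exact: smoothD.
have -> : (fun x t => complex.Im (F x t + G x t)) =
    fun x t => complex.Im (F x t) + complex.Im (G x t).
  by apply/funext => x; apply/funext => t; rewrite ImD.
exact: smoothD.
Qed.

Lemma csmoothM F G :
  csmooth F -> csmooth G -> csmooth (fun x t => F x t * G x t).
Proof.
move=> [F1 F2] [G1 G2]; split => /=.
  have -> : (fun x t => complex.Re (F x t * G x t)) = fun x t =>
      complex.Re (F x t) * complex.Re (G x t)
      + - (complex.Im (F x t) * complex.Im (G x t)).
    by apply/funext => x; apply/funext => t; rewrite ReM.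
  by apply: smoothD; [exact: smoothM | apply: smoothN; exact: smoothM].
have -> : (fun x t => complex.Im (F x t * G x t)) = fun x t =>
    complex.Re (F x t) * complex.Im (G x t)
    + complex.Im (F x t) * complex.Re (G x t).
  by apply/funext => x; apply/funext => t; rewrite ImM.
by apply: smoothD; exact: smoothM.
Qed.

Lemma csmoothJ F : csmooth F -> csmooth (fun x t => (F x t)^*).
Proof.
move=> [F1 F2]; split.
  have -> // : (fun x t => complex.Re (F x t)^*) =
      fun x t => complex.Re (F x t).
  by apply/funext => x; apply/funext => t; rewrite conjCE.
have -> : (fun x t => complex.Im (F x t)^*) = fun x t => - complex.Im (F x t).
  by apply/funext => x; apply/funext => t; rewrite conjCE.
exact: smoothN.
Qed.

Lemma csmooth_real (f : R -> R -> R) :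
  smooth f -> csmooth (fun x t => (f x t)%:C%C).
Proof. by move=> sf; split; [exact: sf | exact: smooth_const]. Qed.

Lemma csmooth_sum n (F : 'I_n -> R -> R -> C) :
  (forall k, csmooth (F k)) -> csmooth (fun x t => \sum_k F k x t).
Proof.
elim: n F => [|n IH] F sF.
  have -> : (fun x t => \sum_k F k x t) = fun _ _ => 0.
    by apply/funext => x; apply/funext => t; rewrite big_ord0.
  exact: csmooth_const.
have -> : (fun x t => \sum_k F k x t) = fun x t =>
    \sum_(k < n) F (widen_ord (leqnSn n) k) x t + F ord_max x t.
  by apply/funext => x; apply/funext => t; rewrite big_ord_recr.
by apply: csmoothD; [apply: IH => k; exact: sF | exact: sF].
Qed.

Lemma csmooth_cpdx F : csmooth F -> csmooth (cpdx F).
Proof. by move=> [F1 F2]; split; exact: smooth_pdx. Qed.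

Lemma csmooth_cpdt F : csmooth F -> csmooth (cpdt F).
Proof. by move=> [F1 F2]; split; exact: smooth_pdt. Qed.

Lemma cschwarz F x t : csmooth F -> cpdx (cpdt F) x t = cpdt (cpdx F) x t.
Proof.
move=> [/(_ 2%N)/schwarz E1 /(_ 2%N)/schwarz E2].
exact: (congr2 (fun f g => (f x t +i* g x t)%C) E1 E2).
Qed.

Lemma msmooth_const m n (A : 'M[C]_(m, n)) : msmooth (fun _ _ : R => A).
Proof. by move=> i j; exact: csmooth_const. Qed.

Lemma msmoothD m n (F G : R -> R -> 'M[C]_(m, n)) :
  msmooth F -> msmooth G -> msmooth (fun x t => F x t + G x t).
Proof.
move=> sF sG i j; have -> : (fun x t => (F x t + G x t) i j) =
    fun x t => F x t i j + G x t i j.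
  by apply/funext => x; apply/funext => t; rewrite mxE.
by apply: csmoothD; [exact: sF | exact: sG].
Qed.

Lemma msmoothM m n p (F : R -> R -> 'M[C]_(m, n)) (G : R -> R -> 'M[C]_(n, p)) :
  msmooth F -> msmooth G -> msmooth (fun x t => F x t *m G x t).
Proof.
move=> sF sG i j; have -> : (fun x t => (F x t *m G x t) i j) =
    fun x t => \sum_k F x t i k * G x t k j.
  by apply/funext => x; apply/funext => t; rewrite mxE.
by apply: csmooth_sum => k; apply: csmoothM; [exact: sF | exact: sG].
Qed.

Lemma msmoothZ m n (f : R -> R -> C) (F : R -> R -> 'M[C]_(m, n)) :
  csmooth f -> msmooth F -> msmooth (fun x t => f x t *: F x t).
Proof.
move=> sf sF i j; have -> : (fun x t => (f x t *: F x t) i j) =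
    fun x t => f x t * F x t i j.
  by apply/funext => x; apply/funext => t; rewrite mxE.
by apply: csmoothM; [exact: sf | exact: sF].
Qed.

Lemma msmoothJ m n (F : R -> R -> 'M[C]_(m, n)) :
  msmooth F -> msmooth (fun x t => (F x t)^t*).
Proof.
move=> sF i j; have -> : (fun x t => (F x t)^t* i j) = fun x t => (F x t j i)^*.
  by apply/funext => x; apply/funext => t; rewrite !mxE.
exact: csmoothJ.
Qed.

Lemma msmoothB m n (F G : R -> R -> 'M[C]_(m, n)) :
  msmooth F -> msmooth G -> msmooth (fun x t => F x t - G x t).
Proof.
move=> sF sG; have -> : (fun x t => F x t - G x t) =
    fun x t => F x t + -1 *: G x t.
  by apply/funext => x; apply/funext => t; rewrite scaleN1r.
by apply: msmoothD => //; apply: msmoothZ => //; exact: csmooth_const.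
Qed.

Lemma msmooth_mpdx m n (F : R -> R -> 'M[C]_(m, n)) :
  msmooth F -> msmooth (mpdx F).
Proof.
move=> sF i j; have -> : (fun x t => mpdx F x t i j) =
    cpdx (fun x t => F x t i j).
  by apply/funext => x; apply/funext => t; rewrite mxE.
exact: csmooth_cpdx.
Qed.

Lemma mschwarz m n (F : R -> R -> 'M[C]_(m, n)) x t :
  msmooth F -> mpdx (mpdt F) x t = mpdt (mpdx F) x t.
Proof.
move=> sF; apply/matrixP => i j; rewrite [LHS]mxE [RHS]mxE.
have Et : (fun x t => mpdt F x t i j) = cpdt (fun x t => F x t i j).
  by apply/funext => x'; apply/funext => t'; rewrite mxE.
have Ex : (fun x t => mpdx F x t i j) = cpdx (fun x t => F x t i j).
  by apply/funext => x'; apply/funext => t'; rewrite mxE.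
apply: etrans (congr1 (fun f => cpdx f x t) Et) _.
apply: etrans (cschwarz _ _ (sF i j)) _.
exact: esym (congr1 (fun f => cpdt f x t) Ex).
Qed.

End ComplexSmooth.

(** * The rotation of R^3 induced by a unitary matrix *)

Section Algebra.
Context {R : realType}.
Notation C := R[i].

Lemma sum2E (V : nmodType) (F : 'I_2 -> V) : \sum_i F i = F 0 + F 1.
Proof.
rewrite !big_ord_recl big_ord0 addr0.
by congr (F _ + F _); apply: val_inj.
Qed.

Lemma sum3E (V : nmodType) (F : 'I_3 -> V) : \sum_i F i = F 0 + F 1 + F 2%:R.
Proof.
rewrite !big_ord_recl big_ord0 addr0 addrA.
by congr (F _ + F _ + F _); apply: val_inj.
Qed.

Lemma forall_ord2 (P : 'I_2 -> Prop) : P 0 -> P 1 -> forall i, P i.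
Proof.
move=> P0 P1 [[|[|//]] li]; first by have -> : Ordinal li = 0 by apply: val_inj.
by have -> : Ordinal li = 1 by apply: val_inj.
Qed.

Lemma forall_ord3 (P : 'I_3 -> Prop) : P 0 -> P 1 -> P 2%:R -> forall i, P i.
Proof.
move=> P0 P1 P2 [[|[|[|//]]] li].
- by have -> : Ordinal li = 0 by apply: val_inj.
- by have -> : Ordinal li = 1 by apply: val_inj.
- by have -> : Ordinal li = 2%:R by apply: val_inj.
Qed.

Lemma mx2_eq (T : Type) (A B : 'M[T]_2) :
  A 0 0 = B 0 0 -> A 0 1 = B 0 1 -> A 1 0 = B 1 0 -> A 1 1 = B 1 1 -> A = B.
Proof.
move=> h00 h01 h10 h11; apply/matrixP.
by apply: forall_ord2; apply: forall_ord2.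
Qed.

Lemma cV3_eq (T : Type) (u v : 'cV[T]_3) :
  u 0 0 = v 0 0 -> u 1 0 = v 1 0 -> u 2%:R 0 = v 2%:R 0 -> u = v.
Proof.
move=> h0 h1 h2; apply/matrixP => i j; rewrite (ord1 j); move: i.
exact: forall_ord3.
Qed.

Lemma mulmx2E (T : pzSemiRingType) m n (A : 'M[T]_(m, 2)) (B : 'M[T]_(2, n)) i j :
  (A *m B) i j = A i 0 * B 0 j + A i 1 * B 1 j.
Proof. by rewrite mxE sum2E. Qed.

Definition mx2 (T : nmodType) (a b c d : T) : 'M[T]_2 :=
  mx_of_rows 2 2 [:: [:: a; b]; [:: c; d]].

Lemma mx2_00 (T : nmodType) (a b c d : T) : mx2 a b c d 0 0 = a.
Proof. by rewrite mxE. Qed.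
Lemma mx2_01 (T : nmodType) (a b c d : T) : mx2 a b c d 0 1 = b.
Proof. by rewrite mxE. Qed.
Lemma mx2_10 (T : nmodType) (a b c d : T) : mx2 a b c d 1 0 = c.
Proof. by rewrite mxE. Qed.
Lemma mx2_11 (T : nmodType) (a b c d : T) : mx2 a b c d 1 1 = d.
Proof. by rewrite mxE. Qed.
Definition mx2E := (mx2_00, mx2_01, mx2_10, mx2_11).

Lemma mx2_eta (T : nmodType) (A : 'M[T]_2) :
  A = mx2 (A 0 0) (A 0 1) (A 1 0) (A 1 1).
Proof. by apply: mx2_eq; rewrite mx2E. Qed.

Lemma mx2D (T : nmodType) (a b c d a' b' c' d' : T) :
  mx2 a b c d + mx2 a' b' c' d' = mx2 (a + a') (b + b') (c + c') (d + d').
Proof. by apply: mx2_eq; rewrite !mxE. Qed.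

Lemma mx2N (T : zmodType) (a b c d : T) :
  - mx2 a b c d = mx2 (- a) (- b) (- c) (- d).
Proof. by apply: mx2_eq; rewrite !mxE. Qed.

Lemma mx2Z (T : pzRingType) (k a b c d : T) :
  k *: mx2 a b c d = mx2 (k * a) (k * b) (k * c) (k * d).
Proof. by apply: mx2_eq; rewrite !mxE. Qed.

Lemma mx2M (T : pzRingType) (a b c d a' b' c' d' : T) :
  mx2 a b c d *m mx2 a' b' c' d' =
  mx2 (a * a' + b * c') (a * b' + b * d') (c * a' + d * c') (c * b' + d * d').
Proof.
by apply: mx2_eq; rewrite mulmx2E !mx2E.
Qed.

Lemma mx2_1 (T : pzRingType) : 1%:M = mx2 1 0 0 1 :> 'M[T]_2.
Proof. by apply: mx2_eq; rewrite !mxE. Qed.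

Lemma mx2J (a b c d : C) : (mx2 a b c d)^t* = mx2 a^* c^* b^* d^*.
Proof. by apply: mx2_eq; rewrite !mxE. Qed.

Lemma su_aE : su_a = mx2 ('i)%C 0 0 (- ('i)%C) :> 'M[C]_2. Proof. by []. Qed.
Lemma su_bE : su_b = mx2 0 1 (-1) 0 :> 'M[C]_2. Proof. by []. Qed.
Lemma su_cE : su_c = mx2 0 ('i)%C ('i)%C 0 :> 'M[C]_2. Proof. by []. Qed.

Lemma su2_ofE (v : 'cV[R]_3) : su2_of v =
  mx2 (0 +i* v 0 0)%C (v 1 0 +i* v 2%:R 0)%C
      (- v 1 0 +i* v 2%:R 0)%C (0 +i* - v 0 0)%C.
Proof.
rewrite /su2_of su_aE su_bE su_cE !mx2Z !mx2D.
by congr mx2; apply/eqP; rewrite eq_complex /= !(mulr0, mulr1, mul0r, mulrN, subr0,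
  addr0, add0r, oppr0, mulrN1, opprK) !eqxx.
Qed.

Definition cV3 (a b c : R) : 'cV[R]_3 := mx_of_rows 3 1 [:: [:: a]; [:: b]; [:: c]].

Lemma cV3_0 (a b c : R) : cV3 a b c 0 0 = a.
Proof. by rewrite mxE. Qed.
Lemma cV3_1 (a b c : R) : cV3 a b c 1 0 = b.
Proof. by rewrite mxE. Qed.
Lemma cV3_2 (a b c : R) : cV3 a b c 2%:R 0 = c.
Proof. by rewrite mxE. Qed.
Definition cV3E := (cV3_0, cV3_1, cV3_2).

Lemma R3_ofE (X : 'M[C]_2) :
  R3_of X = cV3 (complex.Im (X 0 0)) (complex.Re (X 0 1)) (complex.Im (X 0 1)).
Proof. by []. Qed.

(** Being anti-Hermitian and trace-free forces [X 0 0] to be imaginary, [X 1 1 = - X 0 0] and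
    [X 1 0 = - conj (X 0 1)], so the three reals read off by [R3_of] determine [X]. *)
Lemma R3_ofK (X : 'M[C]_2) : X^t* = - X -> \tr X = 0 -> su2_of (R3_of X) = X.
Proof.
move=> /matrixP H; rewrite /mxtrace sum2E => Htr.
have H' i j : (X j i)^* = - X i j by have := H i j; rewrite !mxE.
rewrite su2_ofE R3_ofE !cV3E [RHS]mx2_eta.
have := H' 0 0; have := H' 0 1; move: Htr {H H'}.
move: (X 0 0) (X 0 1) (X 1 0) (X 1 1) => a b c d Htr.
rewrite !conjCE => Hb Ha.
have -> : d = - a by apply/eqP; rewrite -addr_eq0 addrC Htr.
move: Ha Hb; case: a {Htr} => a1 a2; case: b => b1 b2; case: c => c1 c2 /=.
move=> [a1E] [c1E c2E]; congr mx2; apply/eqP; rewrite eq_complex /=;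
  by apply/andP; split; apply/eqP; lra.
Qed.

Lemma su2_ofJ (v : 'cV[R]_3) : (su2_of v)^t* = - su2_of v.
Proof.
rewrite su2_ofE mx2J mx2N; congr mx2; rewrite conjCE; apply/eqP;
  by rewrite eq_complex /= ?(oppr0, opprK) !eqxx.
Qed.

Lemma su2_of_tr (v : 'cV[R]_3) : \tr (su2_of v) = 0.
Proof.
rewrite su2_ofE /mxtrace sum2E !mx2E; apply/eqP.
by rewrite eq_complex /= addr0 subrr !eqxx.
Qed.

Lemma crossE (u v : 'cV[R]_3) : cross u v =
  cV3 (u 1 0 * v 2%:R 0 - u 2%:R 0 * v 1 0)
      (u 2%:R 0 * v 0 0 - u 0 0 * v 2%:R 0)
      (u 0 0 * v 1 0 - u 1 0 * v 0 0).
Proof.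
by apply: cV3_eq; rewrite !cV3E mxE; congr (u _ _ * v _ _ - u _ _ * v _ _);
  apply: val_inj.
Qed.

Lemma dotE (u v : 'cV[R]_3) :
  dot u v = u 0 0 * v 0 0 + u 1 0 * v 1 0 + u 2%:R 0 * v 2%:R 0.
Proof. by rewrite /dot sum3E. Qed.

(** This is the product of imaginary quaternions. Inner and cross product sit in a single matrix
    product, so a multiplicative map such as conjugation preserves both at once. *)
Lemma su2_ofM (u v : 'cV[R]_3) : su2_of u *m su2_of v =
  - ((dot u v)%:C)%C *: 1%:M + su2_of (cross u v).
Proof.
rewrite !su2_ofE mx2M mx2_1 mx2Z mx2D crossE dotE !cV3E.
move: (u 0 0) (u 1 0) (u 2%:R 0) (v 0 0) (v 1 0) (v 2%:R 0).
move=> u0 u1 u2 v0 v1 v2.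
by congr mx2; apply/eqP; rewrite eq_complex /=; apply/andP; split; apply/eqP; ring.
Qed.

Lemma su2_ofD (u v : 'cV[R]_3) : su2_of (u + v) = su2_of u + su2_of v.
Proof.
rewrite !su2_ofE mx2D !mxE.
by congr mx2; apply/eqP; rewrite eq_complex /=; apply/andP; split; apply/eqP; ring.
Qed.

Lemma su2_ofZ (k : R) (u : 'cV[R]_3) : su2_of (k *: u) = (k%:C)%C *: su2_of u.
Proof.
rewrite !su2_ofE mx2Z !mxE.
by congr mx2; apply/eqP; rewrite eq_complex /=; apply/andP; split; apply/eqP; ring.
Qed.

Lemma su2_ofN (u : 'cV[R]_3) : su2_of (- u) = - su2_of u.
Proof.
rewrite -[in LHS]scaleN1r su2_ofZ -[RHS]scaleN1r; congr (_ *: _).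
by apply/eqP; rewrite eq_complex /= oppr0 !eqxx.
Qed.

Lemma su2_of_inj : injective (@su2_of R).
Proof. exact: can_inj su2_ofK. Qed.

Lemma crossC (u v : 'cV[R]_3) : cross u v = - cross v u.
Proof. by rewrite !crossE; apply: cV3_eq; rewrite [RHS]mxE !cV3E; ring. Qed.

Lemma dotC (u v : 'cV[R]_3) : dot u v = dot v u.
Proof. by rewrite !dotE; ring. Qed.

Lemma su2_of_comm (u v : 'cV[R]_3) :
  su2_of u *m su2_of v - su2_of v *m su2_of u = su2_of (2 *: cross u v).
Proof.
rewrite !su2_ofM (dotC v) (crossC v u) su2_ofN opprD addrACA subrr add0r opprK.
by rewrite -su2_ofD scaler_nat mulr2n.
Qed.

End Algebra.

(* Sealed, because unification otherwise unfolds it down to matrix entries. *)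
HB.lock Definition Adv (R : realType) (phi : 'M[R[i]]_2) (v : 'cV[R]_3) :
  'cV[R]_3 := R3_of (phi *m su2_of v *m phi^t*).

Section Rotation.
Context {R : realType}.
Notation C := R[i].

Lemma AdvE (phi : 'M[C]_2) v : Adv phi v = R3_of (phi *m su2_of v *m phi^t*).
Proof. by rewrite unlock. Qed.

Lemma mulmxJ m n p (A : 'M[C]_(m, n)) (B : 'M[C]_(n, p)) :
  (A *m B)^t* = B^t* *m A^t*.
Proof. by rewrite trmx_mul map_mxM. Qed.

Lemma mxJK m n (A : 'M[C]_(m, n)) : A^t* ^t* = A.
Proof. by apply/matrixP => i j; rewrite !mxE conjCK. Qed.

(** Conjugation by a unitary matrix stays inside su(2), where [R3_of] loses nothing. *)
Lemma AdvK (phi : 'M[C]_2) v : phi^t* *m phi = 1%:M ->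
  su2_of (Adv phi v) = phi *m su2_of v *m phi^t*.
Proof.
move=> U; rewrite AdvE; apply: R3_ofK.
  by rewrite !mulmxJ mxJK su2_ofJ mulNmx mulmxN mulmxA.
by rewrite mxtrace_mulC mulmxA U mul1mx su2_of_tr.
Qed.

Lemma AdvD (phi : 'M[C]_2) u v : phi^t* *m phi = 1%:M ->
  Adv phi (u + v) = Adv phi u + Adv phi v.
Proof.
move=> U; apply: su2_of_inj.
rewrite (su2_ofD (Adv phi u) (Adv phi v)) (AdvK (u + v) U) (AdvK u U) (AdvK v U).
by rewrite (su2_ofD u v) mulmxDr mulmxDl.
Qed.

Lemma AdvZ (phi : 'M[C]_2) k v : phi^t* *m phi = 1%:M ->
  Adv phi (k *: v) = k *: Adv phi v.
Proof.
move=> U; apply: su2_of_inj.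
rewrite (su2_ofZ k (Adv phi v)) (AdvK (k *: v) U) (AdvK v U) (su2_ofZ k v).
by rewrite -scalemxAr -scalemxAl.
Qed.

Lemma conj_mulmx n (phi A B : 'M[C]_n) : phi^t* *m phi = 1%:M ->
  (phi *m A *m phi^t*) *m (phi *m B *m phi^t*) = phi *m (A *m B) *m phi^t*.
Proof. by move=> U; rewrite !mulmxA -(mulmxA _ (phi^t*) phi) U mulmx1. Qed.

(** Comparing traces isolates the scalar part. *)
Lemma scalar_traceless_inj (a b : C) (S T : 'M[C]_2) :
  \tr S = 0 -> \tr T = 0 -> a *: 1%:M + S = b *: 1%:M + T -> a = b /\ S = T.
Proof.
rewrite /mxtrace !sum2E => S0 T0 E.
have E' i j : a * (i == j)%:R + S i j = b * (i == j)%:R + T i j.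
  by have /matrixP/(_ i j) := E; rewrite !mxE.
have ab : a = b.
  have := congr2 +%R (E' 0 0) (E' 1 1).
  rewrite !eqxx !mulr1 addrACA S0 addrACA T0 !addr0 -!mulr2n.
  by move/eqP; rewrite -subr_eq0 -mulrnBl mulrn_eq0 subr_eq0 => /eqP.
by split=> //; move: E; rewrite ab => /addrI.
Qed.

(** Conjugation commutes with the quaternion product [su2_ofM] and fixes scalars; the scalar part
    then gives the inner product and the trace-free part the cross product. *)
Lemma Adv_dot_cross (phi : 'M[C]_2) u v : phi^t* *m phi = 1%:M ->
  dot (Adv phi u) (Adv phi v) = dot u v /\
  cross (Adv phi u) (Adv phi v) = Adv phi (cross u v).
Proof.
move=> U; have U' : phi *m phi^t* = 1%:M by apply: mulmx1C.
have E : su2_of (Adv phi u) *m su2_of (Adv phi v) =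
    - ((dot u v)%:C)%C *: 1%:M + su2_of (Adv phi (cross u v)).
  rewrite (AdvK u U) (AdvK v U) (AdvK (cross u v) U) conj_mulmx // su2_ofM.
  by rewrite mulmxDr mulmxDl -scalemxAr -scalemxAl mulmx1 U'.
rewrite su2_ofM in E.
have [/oppr_inj [Ed] /su2_of_inj Ec] :=
  scalar_traceless_inj (su2_of_tr _) (su2_of_tr _) E.
by split.
Qed.

(** The coordinates of [a], [-c], [b] in this order; the sign makes this orthonormal basis
    positively oriented. *)
Definition dvec (j : 'I_3) : 'cV[R]_3 :=
  nth 0 [:: cV3 1 0 0; cV3 0 0 (-1); cV3 0 1 0] j.

Lemma deltaE j : delta j = su2_of (dvec j) :> 'M[C]_2.
Proof.
move: j; apply: forall_ord3; rewrite /delta /dvec /= su2_ofE !cV3E ?su_aE ?su_bE ?su_cE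
  ?mx2N; congr mx2; apply/eqP; by rewrite eq_complex /= ?oppr0 !eqxx.
Qed.

Lemma unitary_invmx n (phi : 'M[C]_n) : phi^t* *m phi = 1%:M ->
  invmx phi = phi^t*.
Proof.
move=> U; have U' := mulmx1C U.
have Hu : phi \in unitmx by case/mulmx1_unit : U.
by rewrite -[LHS]mul1mx -U -mulmxA mulmxV // mulmx1.
Qed.

Lemma col_Ad_delta (phi : 'M[C]_2) j : phi^t* *m phi = 1%:M ->
  col j (Ad_delta phi) = Adv phi (dvec j).
Proof.
move=> U; apply/matrixP => i k; rewrite (ord1 k) [LHS]mxE [LHS]mxE.
by rewrite unitary_invmx // deltaE AdvE.
Qed.

(** Written as a triple product, the determinant of a rotated frame is computed by
    [Adv_dot_cross]. *)
Lemma det3E (A : 'M[R]_3) :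
  \det A = dot (cross (col 0 A) (col 1 A)) (col 2%:R A).
Proof.
have L01 : lift 0 0 = 1 :> 'I_3 by apply: val_inj.
have L02 : lift 0 1 = 2%:R :> 'I_3 by apply: val_inj.
have L10 : lift 1 0 = 0 :> 'I_3 by apply: val_inj.
have L11 : lift 1 1 = 2%:R :> 'I_3 by apply: val_inj.
have L20 : lift 2%:R 0 = 0 :> 'I_3 by apply: val_inj.
have L21 : lift 2%:R 1 = 1 :> 'I_3 by apply: val_inj.
rewrite (expand_det_col _ 0) sum3E /cofactor.
rewrite !(expand_det_row _ 0) !sum2E /cofactor !det_mx11 !mxE /=.
have M0 : lift 0 (0 : 'I_1) = 1 :> 'I_2 by apply: val_inj.
have M1 : lift 1 (0 : 'I_1) = 0 :> 'I_2 by apply: val_inj.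
rewrite !M0 !M1 !L01 !L02 !L10 !L11 !L20 !L21 dotE crossE !cV3E !mxE.
by rewrite !expr0 !expr1 !exprS !expr0; ring.
Qed.

Lemma cross_dvec : cross (dvec 0) (dvec 1) = dvec 2%:R.
Proof. by rewrite crossE /dvec /=; apply: cV3_eq; rewrite !cV3E; ring. Qed.

Lemma dot_dvec i j : dot (dvec i) (dvec j) = (i == j)%:R.
Proof.
move: i j; apply: forall_ord3; apply: forall_ord3;
  by rewrite dotE /dvec /= !cV3E; ring.
Qed.

Lemma SO3_Ad_delta (phi : 'M[C]_2) : phi^t* *m phi = 1%:M -> SO3 (Ad_delta phi).
Proof.
move=> U; split.
  apply/matrixP => i j; rewrite [RHS]mxE -dot_dvec.
  rewrite -(Adv_dot_cross (dvec i) (dvec j) U).1 -!col_Ad_delta // /dot mxE.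
  by apply: eq_bigr => k _; rewrite !mxE.
rewrite det3E !col_Ad_delta // (Adv_dot_cross _ _ U).2 cross_dvec.
by rewrite (Adv_dot_cross _ _ U).1 dot_dvec eqxx.
Qed.

End Rotation.

(** * Derivatives of real matrices and of rotated vectors *)

Section RealMatrixDerivative.
Context {R : realType}.
Notation C := R[i].
Implicit Types s : R.

Definition rderive m n (F : R -> 'M[R]_(m, n)) s (D : 'M[R]_(m, n)) : Prop :=
  forall i j, is_derive s 1 (fun r => F r i j) (D i j).

Lemma rderiveM m n p (F : R -> 'M[R]_(m, n)) (G : R -> 'M[R]_(n, p)) s dF dG :
  rderive F s dF -> rderive G s dG ->
  rderive (fun r => F r *m G r) s (dF *m G s + F s *m dG).
Proof.
move=> DF DG i j; have -> : (fun r => (F r *m G r) i j) =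
    fun r => \sum_k F r i k * G r k j by apply/funext => r; rewrite mxE.
have -> : (dF *m G s + F s *m dG) i j =
    \sum_k (dF i k * G s k j + F s i k * dG k j).
  by rewrite big_split /= mxE; congr (_ + _); rewrite mxE.
by apply: is_deriv_sum => k; apply: is_derivM; [exact: DF | exact: DG].
Qed.

Lemma rderiveT m n (F : R -> 'M[R]_(m, n)) s dF :
  rderive F s dF -> rderive (fun r => (F r)^T) s dF^T.
Proof.
move=> DF i j; have -> : (fun r => (F r)^T i j) = fun r => F r j i.
  by apply/funext => r; rewrite mxE.
by rewrite mxE; exact: DF.
Qed.

Lemma rderive_eq m n (F : R -> 'M[R]_(m, n)) s D D' :
  rderive F s D -> D = D' -> rderive F s D'.
Proof. by move=> H <-. Qed.

Lemma rderive_congr m n (F G : R -> 'M[R]_(m, n)) s D :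
  (forall r, F r = G r) -> rderive F s D -> rderive G s D.
Proof. by move=> /funext ->. Qed.

Lemma rderive_derive1 m n (F : R -> 'M[R]_(m.+1, n.+1)) s D :
  rderive F s D -> F^`()%classic s = D.
Proof.
move=> DF; rewrite derive1E derive_mx.
  by apply/matrixP => i j; rewrite mxE; exact: (@derive_val _ _ _ _ _ _ _ (DF i j)).
by apply/derivable_mxP => i j; case: (DF i j).
Qed.

Lemma derivable_rderive m n (F : R -> 'M[R]_(m.+1, n.+1)) s :
  derivable F s 1 -> rderive F s (F^`()%classic s).
Proof.
move=> dF i j; rewrite derive1E derive_mx // mxE.
exact/derivableP/(derivable_mxP _ _ _).1.
Qed.

Lemma rderive_R3_of (X : R -> 'M[C]_2) s D :
  mderive X s D -> rderive (fun r => R3_of (X r)) s (R3_of D).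
Proof.
move=> DX i j; rewrite (ord1 j); move: i; apply: forall_ord3.
- have -> : (fun r => R3_of (X r) 0 0) = fun r => complex.Im (X r 0 0).
    by apply/funext => r; rewrite R3_ofE cV3E.
  by rewrite R3_ofE cV3E; exact: (DX 0 0).2.
- have -> : (fun r => R3_of (X r) 1 0) = fun r => complex.Re (X r 0 1).
    by apply/funext => r; rewrite R3_ofE cV3E.
  by rewrite R3_ofE cV3E; exact: (DX 0 1).1.
- have -> : (fun r => R3_of (X r) 2%:R 0) = fun r => complex.Im (X r 0 1).
    by apply/funext => r; rewrite R3_ofE cV3E.
  by rewrite R3_ofE cV3E; exact: (DX 0 1).2.
Qed.

Lemma mderive_su2_of (v : R -> 'cV[R]_3) s d :
  rderive v s d -> mderive (fun r => su2_of (v r)) s (su2_of d).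
Proof.
move=> Dv.
have D k (A : 'M[C]_2) : mderive (fun r => ((v r k 0)%:C)%C *: A) s
    (((d k 0)%:C)%C *: A).
  have Dc : cderive (fun r => ((v r k 0)%:C)%C) s ((d k 0)%:C)%C.
    by split; [exact: Dv | exact: is_derive_cst].
  apply: mderive_eq (mderiveZ Dc (mderive_cst A s)) _.
  by rewrite scaler0 addr0.
exact: mderiveD (mderiveD (D _ _) (D _ _)) (D _ _).
Qed.

(** The left side is the derivative of [phi V phi^*] along [phi' = phi W] with [V] constant; an
    anti-Hermitian [W] turns it into a conjugated bracket. *)
Lemma conj_commutator n (phi W V : 'M[C]_n) : W^t* = - W ->
  phi *m W *m V *m phi^t* + phi *m V *m (phi *m W)^t* =
  phi *m (W *m V - V *m W) *m phi^t*.
Proof.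
move=> HW; rewrite mulmxJ HW mulNmx mulmxN mulmxBr mulmxBl !mulmxA.
by [].
Qed.

(** The derivative is the conjugate of the bracket of [w] and [v], and the bracket in su(2) is twice
    the cross product. *)
Lemma rderive_Adv (phi : R -> 'M[C]_2) s w v :
  (phi s)^t* *m phi s = 1%:M ->
  mderive phi s (phi s *m su2_of w) ->
  rderive (fun r => Adv (phi r) v) s (Adv (phi s) (2 *: cross w v)).
Proof.
move=> U D.
apply: (@rderive_congr _ _ (fun r => R3_of (phi r *m su2_of v *m (phi r)^t*))).
  by move=> r; rewrite AdvE.
have H := mderiveM (mderiveM D (mderive_cst (su2_of v) s)) (mderiveJ D).
apply: rderive_eq (rderive_R3_of H) _.
by rewrite AdvE -su2_of_comm mulmx0 addr0 (conj_commutator _ _ (su2_ofJ w)).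
Qed.

End RealMatrixDerivative.

(** * Smoothness of the rotated frame *)

Section RotSmooth.
Context {R : realType}.
Notation C := R[i].

Lemma smooth_R3_of (X : R -> R -> 'M[C]_2) :
  msmooth X -> smooth (fun x t => R3_of (X x t)).
Proof.
move=> sX; apply/smooth_mxP => i j; rewrite (ord1 j); move: i; apply: forall_ord3.
- have -> : (fun x t => R3_of (X x t) 0 0) = fun x t => complex.Im (X x t 0 0).
    by apply/funext => x; apply/funext => t; rewrite R3_ofE cV3E.
  exact: (sX 0 0).2.
- have -> : (fun x t => R3_of (X x t) 1 0) = fun x t => complex.Re (X x t 0 1).
    by apply/funext => x; apply/funext => t; rewrite R3_ofE cV3E.
  exact: (sX 0 1).1.
- have -> : (fun x t => R3_of (X x t) 2%:R 0) = fun x t => complex.Im (X x t 0 1).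
    by apply/funext => x; apply/funext => t; rewrite R3_ofE cV3E.
  exact: (sX 0 1).2.
Qed.

Lemma msmooth_su2_of (v : R -> R -> 'cV[R]_3) :
  smooth v -> msmooth (fun x t => su2_of (v x t)).
Proof.
move=> /smooth_mxP sv; rewrite /su2_of.
by do 2?apply: msmoothD; apply: msmoothZ;
  [exact: csmooth_real (sv _ _) | exact: msmooth_const
  |exact: csmooth_real (sv _ _) | exact: msmooth_const
  |exact: csmooth_real (sv _ _) | exact: msmooth_const].
Qed.

Lemma smooth_Ad_delta (phi : R -> R -> 'M[C]_2) :
  msmooth phi -> (forall x t, (phi x t)^t* *m phi x t = 1%:M) ->
  smooth (fun x t => Ad_delta (phi x t)).
Proof.
move=> sphi U; apply/smooth_mxP => i j.
have -> : (fun x t => Ad_delta (phi x t) i j) =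
    fun x t => R3_of (phi x t *m delta j *m (phi x t)^t*) i 0.
  by apply/funext => x; apply/funext => t; rewrite [LHS]mxE unitary_invmx.
apply: (smooth_mxP _).1; apply: smooth_R3_of.
apply: msmoothM; last exact: msmoothJ.
by apply: msmoothM => //; exact: msmooth_const.
Qed.

End RotSmooth.

(** * Frames at the spectral parameter 0 *)

Section LaxFrame.
Context {R : realType}.
Notation C := R[i].
Implicit Types (q : R -> R -> C) (phi : R -> R -> 'M[C]_2).

(** The Lax system at spectral parameter 0, where [A(l)] reduces to [u] and [B(l)] to
    [Q_{-1}(u)]. *)
Definition lax_frame q phi : Prop :=
  [/\ msmooth phi,
      forall x t, (phi x t)^t* *m phi x t = 1%:M,
      forall x t, mpdx phi x t = phi x t *m lax_u q x t &
      forall x t, mpdt phi x t = phi x t *m lax_Q q x t].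

(** [uvec] and [Qvec] are the vectors in R^3 of the Lax matrices [lax_u] and [lax_Q]. *)
Definition uvec q x t : 'cV[R]_3 :=
  cV3 0 (complex.Re (q x t)) (complex.Im (q x t)).

Definition Qvec q x t : 'cV[R]_3 :=
  cV3 (- ((complex.Re (q x t) ^+ 2 + complex.Im (q x t) ^+ 2) / 2))
      (- (complex.Im (cpdx q x t) / 2)) (complex.Re (cpdx q x t) / 2).

Lemma lax_uE q x t : lax_u q x t = su2_of (uvec q x t).
Proof.
rewrite su2_ofE !cV3E /lax_u conjCE; congr mx2; case: (q x t) => a b //=;
  by apply/eqP; rewrite eq_complex /= ?oppr0 ?opprK !eqxx.
Qed.

Lemma lax_QE q x t : lax_Q q x t = su2_of (Qvec q x t).
Proof.
rewrite su2_ofE !cV3E /lax_Q -/(mx2 _ _ _ _) mx2Z normCK !conjCE.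
have -> : ('i / 2 : C)%C = (0 +i* 2^-1)%C.
  by rewrite -[2 : C](rmorph_nat (real_complex R)) -fmorphV; apply/eqP;
     rewrite eq_complex /=; apply/andP; split; apply/eqP; ring.
case: (q x t) (cpdx q x t) => a b [c d] /=.
by congr mx2; apply/eqP; rewrite eq_complex /=; apply/andP; split; apply/eqP; ring.
Qed.

Lemma lax_frame_dx q phi x t : lax_frame q phi ->
  mderive (phi ^~ t) x (phi x t *m su2_of (uvec q x t)).
Proof.
case=> sphi _ Hx _; rewrite -lax_uE -Hx; exact: msmooth_mderive_x.
Qed.

Lemma lax_frame_dt q phi x t : lax_frame q phi ->
  mderive (phi x) t (phi x t *m su2_of (Qvec q x t)).
Proof.
case=> sphi _ _ Ht; rewrite -lax_QE -Ht; exact: msmooth_mderive_t.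
Qed.

(** The potential inherits its smoothness from the frame, through [u = phi^* phi_x]. *)
Lemma msmooth_lax_u q phi : lax_frame q phi -> msmooth (lax_u q).
Proof.
case=> sphi U Hx _.
have -> : lax_u q = fun x t => (phi x t)^t* *m mpdx phi x t.
  apply/funext => x; apply/funext => t.
  by rewrite Hx mulmxA U mul1mx.
by apply: msmoothM; [exact: msmoothJ | exact: msmooth_mpdx].
Qed.

Lemma msmooth_mpdt m n (F : R -> R -> 'M[C]_(m, n)) :
  msmooth F -> msmooth (mpdt F).
Proof.
move=> sF i j; have -> : (fun x t => mpdt F x t i j) =
    cpdt (fun x t => F x t i j).
  by apply/funext => x; apply/funext => t; rewrite mxE.
exact: csmooth_cpdt.
Qed.

Lemma msmooth_lax_Q q phi : lax_frame q phi -> msmooth (lax_Q q).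
Proof.
case=> sphi U _ Ht.
have -> : lax_Q q = fun x t => (phi x t)^t* *m mpdt phi x t.
  apply/funext => x; apply/funext => t.
  by rewrite Ht mulmxA U mul1mx.
by apply: msmoothM; [exact: msmoothJ | exact: msmooth_mpdt].
Qed.

Lemma lax_u01 q : (fun x t => lax_u q x t 0 1) = q.
Proof. by apply/funext => x; apply/funext => t; rewrite mxE. Qed.

Lemma csmooth_of_lax_frame q phi : lax_frame q phi -> csmooth q.
Proof. by move=> /msmooth_lax_u/(_ 0 1); rewrite lax_u01. Qed.

(** Both sides are [phi^*] times a mixed second derivative of [phi], and the mixed derivatives
    agree. *)
Lemma zero_curvature q phi x t : lax_frame q phi ->
  lax_u q x t *m lax_Q q x t + mpdx (lax_Q q) x t =
  lax_Q q x t *m lax_u q x t + mpdt (lax_u q) x t.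
Proof.
move=> L; case: (L) => sphi U Hx Ht.
have Du : mderive (lax_u q x) t (mpdt (lax_u q) x t).
  exact: msmooth_mderive_t (msmooth_lax_u L).
have DQ : mderive (lax_Q q ^~ t) x (mpdx (lax_Q q) x t).
  exact: msmooth_mderive_x (msmooth_lax_Q L).
have Dx : mderive (phi ^~ t) x (phi x t *m lax_u q x t).
  by rewrite -Hx; exact: msmooth_mderive_x.
have Dt : mderive (phi x) t (phi x t *m lax_Q q x t).
  by rewrite -Ht; exact: msmooth_mderive_t.
have Ext : mpdx (mpdt phi) x t =
    phi x t *m (lax_u q x t *m lax_Q q x t + mpdx (lax_Q q) x t).
  apply: mderive_mpdx; rewrite mulmxDr mulmxA.
  by apply: mderive_congr (mderiveM Dx DQ) => r; rewrite Ht.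
have Etx : mpdt (mpdx phi) x t =
    phi x t *m (lax_Q q x t *m lax_u q x t + mpdt (lax_u q) x t).
  apply: mderive_mpdt; rewrite mulmxDr mulmxA.
  by apply: mderive_congr (mderiveM Dt Du) => r; rewrite Hx.
have E := etrans (esym Ext) (etrans (mschwarz x t sphi) Etx).
by rewrite -[LHS]mul1mx -(U x t) -mulmxA E mulmxA U mul1mx.
Qed.

(** This is entry [(0, 1)] of the zero curvature equation: the derivative of [Q] contributes
    [(i/2) q_xx] and the commutator of [u] and [Q] contributes [i |q|^2 q]. *)
Lemma NLS_of_lax_frame q phi : lax_frame q phi -> NLS q.
Proof.
move=> L; have sq := csmooth_of_lax_frame L; split=> // x t.
have Eut : mpdt (lax_u q) x t 0 1 = cpdt q x t by rewrite mxE lax_u01.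
have EQx : mpdx (lax_Q q) x t 0 1 = 'i%C / 2 * cpdx (cpdx q) x t.
  have D := csmooth_cderive_x x t (csmooth_cpdx sq).
  rewrite mxE; apply: cderive_cpdx.
  have -> : (fun r => lax_Q q r t 0 1) = fun r => 'i%C / 2 * cpdx q r t.
    by apply/funext => r; rewrite !mxE.
  apply: cderive_eq (cderiveM (cderive_cst _ _) D) _.
  by rewrite mul0r add0r.
have /matrixP/(_ 0 1) := zero_curvature x t L.
rewrite !mxE !sum2E in Eut EQx *; rewrite Eut EQx.
have q00 : lax_u q x t 0 0 = 0 by rewrite mxE.
have q01 : lax_u q x t 0 1 = q x t by rewrite mxE.
have q11 : lax_u q x t 1 1 = 0 by rewrite mxE.
have Q00 : lax_Q q x t 0 0 = 'i%C / 2 * - `|q x t| ^+ 2 by rewrite !mxE.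
have Q11 : lax_Q q x t 1 1 = 'i%C / 2 * `|q x t| ^+ 2 by rewrite !mxE.
rewrite q00 q01 q11 Q00 Q11.
move: (`|q x t| ^+ 2) (cpdt q x t) (cpdx (cpdx q) x t) => n qt qxx.
move: (q x t) ('i%C : C) => qq I; rewrite mul0r add0r mulr0 addr0 => E.
apply: (addrI (I / 2 * - n * qq)); rewrite -E; by field.
Qed.

(** The matrix of [v |-> 2 w x v] (cross product) in the basis [dvec], hence the coefficient matrix
    of the moving frame [Ad_delta phi]. *)
Definition adM (w : 'cV[R]_3) : 'M[R]_3 := mx_of_rows 3 3
  [:: [:: 0;              - (2 * w 1 0);    - (2 * w 2%:R 0)];
      [:: 2 * w 1 0;      0;                - (2 * w 0 0)];
      [:: 2 * w 2%:R 0;   2 * w 0 0;        0]].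

Lemma adME w : [/\ [/\ adM w 0 0 = 0, adM w 0 1 = - (2 * w 1 0) &
                      adM w 0 2%:R = - (2 * w 2%:R 0)],
  [/\ adM w 1 0 = 2 * w 1 0, adM w 1 1 = 0 & adM w 1 2%:R = - (2 * w 0 0)] &
  [/\ adM w 2%:R 0 = 2 * w 2%:R 0, adM w 2%:R 1 = 2 * w 0 0 &
      adM w 2%:R 2%:R = 0]].
Proof. by split; split; rewrite mxE. Qed.

Lemma adM_skew w : (adM w)^T = - adM w.
Proof.
case: (adME w) => [[e00 e01 e02] [e10 e11 e12] [e20 e21 e22]].
apply/matrixP; apply: forall_ord3; apply: forall_ord3;
  by rewrite mxE [RHS]mxE ?e00 ?e01 ?e02 ?e10 ?e11 ?e12 ?e20 ?e21 ?e22
    ?oppr0 ?opprK.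
Qed.

Lemma cross_dvec_adM w j :
  2 *: cross w (dvec j) = \sum_k adM w k j *: dvec k.
Proof.
rewrite sum3E; case: (adME w) => [[e00 e01 e02] [e10 e11 e12] [e20 e21 e22]].
move: j; apply: forall_ord3;
  rewrite ?e00 ?e01 ?e02 ?e10 ?e11 ?e12 ?e20 ?e21 ?e22 /dvec /=;
  by apply: cV3_eq; rewrite crossE [LHS]mxE [RHS]mxE [X in _ = X + _]mxE
    [X in _ = X + _ + _]mxE [X in _ = _ + X + _]mxE [X in _ = _ + X]mxE !cV3E; ring.
Qed.

Lemma scale_cV3 (k a b c : R) : k *: cV3 a b c = cV3 (k * a) (k * b) (k * c).
Proof. by apply: cV3_eq; rewrite [LHS]mxE !cV3E. Qed.

Lemma Adv_sum (phi : 'M[C]_2) (c : 'I_3 -> R) (v : 'I_3 -> 'cV[R]_3) :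
  phi^t* *m phi = 1%:M ->
  Adv phi (\sum_k c k *: v k) = \sum_k c k *: Adv phi (v k).
Proof. by move=> U; rewrite !sum3E !(AdvD _ _ U) !(AdvZ _ _ U). Qed.

Lemma Ad_deltaE (phi : 'M[C]_2) i j : phi^t* *m phi = 1%:M ->
  Ad_delta phi i j = Adv phi (dvec j) i 0.
Proof. by move=> U; rewrite -col_Ad_delta // [RHS]mxE. Qed.

Lemma rderive_Ad_delta (phi : R -> 'M[C]_2) s w :
  (forall r, (phi r)^t* *m phi r = 1%:M) ->
  mderive phi s (phi s *m su2_of w) ->
  rderive (fun r => Ad_delta (phi r)) s (Ad_delta (phi s) *m adM w).
Proof.
move=> U D i j; have := rderive_Adv (dvec j) (U s) D i 0.
rewrite cross_dvec_adM (Adv_sum _ _ (U s)).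
have -> : (\sum_k adM w k j *: Adv (phi s) (dvec k)) i 0 =
    (Ad_delta (phi s) *m adM w) i j.
  rewrite summxE [RHS]mxE; apply: eq_bigr => k _.
  by rewrite [LHS]mxE (Ad_deltaE _ _ (U s)) mulrC.
have -> // : (fun r => Adv (phi r) (dvec j) i 0) = fun r => Ad_delta (phi r) i j.
by apply/funext => r; rewrite (Ad_deltaE _ _ (U r)).
Qed.

(** The derivative of [g h^T] is [g (M + M^T) h^T = 0]. This gives uniqueness for the frame
    equations without a general theorem on differential equations. *)
Lemma skew_flow_const n (g h M : R -> 'M[R]_n) :
  (forall s, rderive g s (g s *m M s)) -> (forall s, rderive h s (h s *m M s)) ->
  (forall s, (M s)^T = - M s) ->
  forall r s, g r *m (h r)^T = g s *m (h s)^T.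
Proof.
move=> Dg Dh skew r s; apply/matrixP => i j.
apply: (is_derive_0_is_cst (f := fun s => (g s *m (h s)^T) i j)) => x.
have := rderiveM (Dg x) (rderiveT (Dh x)).
by rewrite trmx_mul skew mulNmx mulmxN mulmxA subrr => /(_ i j); rewrite mxE.
Qed.

(** For [q = (k1 + i k2) / 2] the two matrices prescribed for an adapted p-frame are exactly
    [adM (uvec q x t)] and [adM (Qvec q x t)], the coefficients of [Ad_delta phi]. *)
Lemma adapted_p_frame_Ad_delta gamma g k1 k2 q phi :
  adapted_p_frame gamma g k1 k2 ->
  (forall x t, q x t = (k1 x t +i* k2 x t)%C / 2) ->
  lax_frame q phi -> g 0 0 = Ad_delta (phi 0 0) ->
  forall x t, g x t = Ad_delta (phi x t).
Proof.
case=> [[sg SOg] _ _ Hx Ht] Hq L g00.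
have [sphi U _ _] := L.
have Eq x t : q x t = ((k1 x t / 2) +i* (k2 x t / 2))%C.
  rewrite Hq -[2 : C](rmorph_nat (real_complex R)) -fmorphV; apply/eqP.
  by rewrite eq_complex /=; apply/andP; split; apply/eqP; ring.
have Re_q x t : complex.Re (q x t) = k1 x t / 2 by rewrite Eq.
have Im_q x t : complex.Im (q x t) = k2 x t / 2 by rewrite Eq.
(* Here [f] is the real or imaginary part of [q]; writing [k = 2 f] transfers derivability from [q]
   to the curvature. *)
have half_pd (f k : R -> R -> R) x t : smooth f ->
    (forall x t, f x t = k x t / 2) -> pdx f x t = pdx k x t / 2.
  move=> sf Ef; have -> : k = fun x t => 2 * f x t.
    by apply/funext => x'; apply/funext => t'; rewrite Ef; field.
  have Df : is_derive x 1 (f ^~ t) (pdx f x t).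
    by rewrite /pdx derive1E; exact/derivableP/smooth_derivable_x.
  rewrite [in RHS]/pdx derive1E.
  have Dc : is_derive x 1 (fun _ : R => 2 : R) 0 by exact: is_derive_cst.
  have -> := @derive_val _ _ _ _ _ _ _ (is_derivM Dc Df).
  by rewrite mul0r add0r; field.
have [sRe sIm] := csmooth_of_lax_frame L.
have Re_qx x t : complex.Re (cpdx q x t) = pdx k1 x t / 2.
  exact: half_pd sRe Re_q.
have Im_qx x t : complex.Im (cpdx q x t) = pdx k2 x t / 2.
  exact: half_pd sIm Im_q.
have gunit x t : g x t \in unitmx.
  by have [/mulmx1_unit[]] := SOg x t.
have Dgx x t : rderive (g ^~ t) x (g x t *m adM (uvec q x t)).
  have -> : g x t *m adM (uvec q x t) = pdx g x t.
    rewrite -[RHS]mul1mx -(mulmxV (gunit x t)) -mulmxA Hx; congr (_ *m _).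
    case: (adME (uvec q x t)) => [[e00 e01 e02] [e10 e11 e12] [e20 e21 e22]].
    apply/matrixP; apply: forall_ord3; apply: forall_ord3;
      by rewrite ?e00 ?e01 ?e02 ?e10 ?e11 ?e12 ?e20 ?e21 ?e22 [RHS]mxE /=
        ?cV3E ?Re_q ?Im_q; field.
  exact: (@derivable_rderive _ _ _ (g ^~ t) x (@smooth_derivable_x _ _ g x t sg)).
have Dgt x t : rderive (g x) t (g x t *m adM (Qvec q x t)).
  have -> : g x t *m adM (Qvec q x t) = pdt g x t.
    rewrite -[RHS]mul1mx -(mulmxV (gunit x t)) -mulmxA Ht; congr (_ *m _).
    case: (adME (Qvec q x t)) => [[e00 e01 e02] [e10 e11 e12] [e20 e21 e22]].
    apply/matrixP; apply: forall_ord3; apply: forall_ord3;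
      by rewrite ?e00 ?e01 ?e02 ?e10 ?e11 ?e12 ?e20 ?e21 ?e22 [RHS]mxE /=
        ?cV3E ?Re_q ?Im_q ?Re_qx ?Im_qx; field.
  exact: (@derivable_rderive _ _ _ (g x) t (@smooth_derivable_t _ _ g x t sg)).
have Dhx x t : rderive (fun r => Ad_delta (phi r t)) x
    (Ad_delta (phi x t) *m adM (uvec q x t)).
  by apply: rderive_Ad_delta (lax_frame_dx _ _ L) => r; exact: U.
have Dht x t : rderive (fun r => Ad_delta (phi x r)) t
    (Ad_delta (phi x t) *m adM (Qvec q x t)).
  by apply: rderive_Ad_delta (lax_frame_dt _ _ L) => r; exact: U.
have SOh x t : SO3 (Ad_delta (phi x t)) := SO3_Ad_delta (U x t).
(* The product is constant in x for fixed t, and in t along [x = 0], so its value is carried from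
   [(x, t)] to [(0, t)] and on to the origin. *)
move=> x t; have : g x t *m (Ad_delta (phi x t))^T = 1%:M.
  rewrite (skew_flow_const (Dgx ^~ t) (Dhx ^~ t) (fun s => adM_skew _) x 0).
  rewrite (skew_flow_const (Dgt 0) (Dht 0) (fun s => adM_skew _) t 0) g00.
  by apply: mulmx1C; case: (SOh 0 0).
move=> E; rewrite -[LHS]mulmx1; have [<- _] := SOh x t.
by rewrite mulmxA E mul1mx.
Qed.

Lemma lax_frame_Adv q phi v x t : lax_frame q phi ->
  rderive (fun r => Adv (phi r t) v) x
    (Adv (phi x t) (2 *: cross (uvec q x t) v)).
Proof.
move=> L; case: (L) => _ U _ _.
exact: rderive_Adv (U x t) (lax_frame_dx x t L).
Qed.

(** Pulled back by [phi], the tangent is [e = dvec 0] and its x-derivative is [2 u x e]. Since [u]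
    is orthogonal to the unit vector [e], the double cross product [e x (u x e)] is [u]. *)
Lemma lax_frame_flow q phi (gamma : R -> R -> 'cV[R]_3) x t :
  lax_frame q phi ->
  (forall x t, pdx gamma x t = Adv (phi x t) (dvec 0)) ->
  2^-1 *: cross (pdx gamma x t) (pdx (pdx gamma) x t) =
  Adv (phi x t) (uvec q x t).
Proof.
move=> L Hx; case: (L) => _ U _ _.
have -> : pdx (pdx gamma) x t =
    Adv (phi x t) (2 *: cross (uvec q x t) (dvec 0)).
  apply: rderive_derive1.
  by apply: rderive_congr (lax_frame_Adv _ _ _ L) => r; rewrite Hx.
rewrite Hx (Adv_dot_cross _ _ (U x t)).2 -AdvZ //; congr (Adv _ _).
rewrite crossE /dvec /= !cV3E scale_cV3 crossE !cV3E scale_cV3.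
by rewrite !cV3E; congr cV3; field.
Qed.

(** As [Adv phi] preserves inner and cross products, every claim reduces to a computation with
    [uvec] and the fixed vectors [dvec]. *)
Lemma lax_frame_curve q phi (gamma : R -> R -> 'cV[R]_3) :
  lax_frame q phi -> smooth gamma ->
  (forall x t, pdx gamma x t = Adv (phi x t) (dvec 0)) ->
  (forall x t, pdt gamma x t = Adv (phi x t) (uvec q x t)) ->
  [/\ curve_flow gamma /\ (forall t, arc_length (gamma ^~ t)),
      forall t, p_frame (gamma ^~ t) (fun x => Ad_delta (phi x t)) &
      forall x t, princ_curv 1 (fun x => Ad_delta (phi x t)) x =
                    2 * complex.Re (q x t) /\
                  princ_curv 2%:R (fun x => Ad_delta (phi x t)) x =
                    2 * complex.Im (q x t)].
Proof.
move=> L sgam Hx Ht; have [sphi U _ _] := L.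
have Dcol j x t : (fun r => col j (Ad_delta (phi r t)))^`()%classic x =
    Adv (phi x t) (2 *: cross (uvec q x t) (dvec j)).
  apply: rderive_derive1.
  by apply: rderive_congr (lax_frame_Adv _ _ _ L) => r; rewrite col_Ad_delta.
have arc t : arc_length (gamma ^~ t).
  move=> s; rewrite /enorm; have -> : (gamma ^~ t)^`()%classic s = pdx gamma s t by [].
  by rewrite Hx (Adv_dot_cross _ _ (U s t)).1 dot_dvec eqxx sqrtr1.
split; first split=> //.
- by split=> // x t; rewrite Ht (lax_frame_flow _ _ L Hx).
- move=> t; split.
  + by split; [exact: smooth_slice | exact: arc].
  + by apply: (@smooth_slice _ _ (fun x t => Ad_delta (phi x t))); exact: smooth_Ad_delta.
  + by move=> s; exact: SO3_Ad_delta.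
  + by move=> s; rewrite col_Ad_delta // -Hx.
  + move=> i s i0 /=; rewrite Dcol !col_Ad_delta //.
    (* [uvec] lies in the plane of [dvec 1] and [dvec 2], so its cross product with either is along
       [dvec 0]: the frame is parallel. The factors are minus the principal curvatures. *)
    have [c ->] : exists c, 2 *: cross (uvec q s t) (dvec i) = c *: dvec 0.
      move: i i0; apply: forall_ord3 => // _.
        exists (- (2 * complex.Re (q s t))).
        by rewrite crossE /dvec /= !cV3E !scale_cV3; congr cV3; ring.
      exists (- (2 * complex.Im (q s t))).
      by rewrite crossE /dvec /= !cV3E !scale_cV3; congr cV3; ring.
    rewrite (Adv_dot_cross _ _ (U s t)).1 AdvZ // dotE /dvec /= scale_cV3 !cV3E.
    by rewrite !mulr0 !mulr1 !addr0 subrr.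
- move=> x t; rewrite /princ_curv Dcol !col_Ad_delta //.
  rewrite !(Adv_dot_cross _ _ (U x t)).1 !dotE !crossE /dvec /=.
  by rewrite !scale_cV3 !cV3E; split; ring.
Qed.

End LaxFrame.

(** * Dressing identities *)

Section DressingAlgebra.
Variables (F : numFieldType) (I r s sb q qb qx qbx al be : F).
Variables (P A U Q U' Q' Dx Dt : 'M[F]_2).
(** The coefficient of [l] in the gauge identity forces [U' = U + (al - be) (A P - P A)], and the
    commutator has off-diagonal entries [2 I s] and [- 2 I sb]. *)
Let k := 2 * I * (al - be).
Hypotheses (HI : I * I = -1) (Hr : r * r = r - s * sb).
Hypotheses (HP : P = mx2 r s sb (1 - r)) (HA : A = mx2 I 0 0 (- I)).
Hypotheses (HU : U = mx2 0 q (- qb) 0).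
Hypotheses (HQ : Q = (I / 2) *: mx2 (- (q * qb)) qx qbx (q * qb)).
Hypotheses (HDx : Dx = P *m (be *: A + U) *m (1%:M - P) -
                       (1%:M - P) *m (al *: A + U) *m P).
Hypotheses (HDt : Dt = P *m (be ^+ 2 *: A + be *: U + Q) *m (1%:M - P) -
                       (1%:M - P) *m (al ^+ 2 *: A + al *: U + Q) *m P).
Hypotheses (HU' : U' = mx2 0 (q + k * s) (- (qb + k * sb)) 0).
Hypotheses (HQ' : Q' = (I / 2) *:
  mx2 (- ((q + k * s) * (qb + k * sb))) (qx + k * Dx 0 1)
      (qbx + k * Dx 1 0) ((q + k * s) * (qb + k * sb))).
Let mxs := (mx2M, mx2D, mx2N, mx2Z, mx2E, mx2_1).

(** The gauge identity in x multiplied by [l - be]. The letters [be], [sb], [qb], [qbx] stand for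
    conjugates, and [Hr] is the scalar content of [P^2 = P]. *)
Lemma dressing_x l :
  (l *: A + U) *m ((l - be) *: P + (l - al) *: (1%:M - P)) + (al - be) *: Dx =
  ((l - be) *: P + (l - al) *: (1%:M - P)) *m (l *: A + U').
Proof.
rewrite HDx HU' HP HA HU /k !mxs.
by congr mx2; ring: HI Hr.
Qed.

(** [Dx] enters as well, because [Q'] contains the x-derivative of the dressed potential. *)
Lemma dressing_t l :
  (l ^+ 2 *: A + l *: U + Q) *m ((l - be) *: P + (l - al) *: (1%:M - P)) +
    (al - be) *: Dt =
  ((l - be) *: P + (l - al) *: (1%:M - P)) *m (l ^+ 2 *: A + l *: U' + Q').
Proof.
rewrite HDt HQ' HDx HQ HU' HP HA HU /k !mxs.
by congr mx2; field: HI Hr.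
Qed.

(** The x-derivative of the corrected curve, pulled back by [phi] and multiplied by [al be], should
    be [al be h(0) A h(0)^-1]; the outer factors on the right are [be h(0)] and [al h(0)^-1]. In
    [sym_t] the frame coefficient is [Q] and the curve velocity is [U]. *)
Lemma sym_x : (al * be) *: A - (al - be) *: (U *m P - P *m U + Dx) =
  (be *: P + al *: (1%:M - P)) *m A *m (al *: P + be *: (1%:M - P)).
Proof.
rewrite HDx HP HA HU !mxs.
by congr mx2; ring: HI Hr.
Qed.

Lemma sym_t : (al * be) *: U - (al - be) *: (Q *m P - P *m Q + Dt) =
  (be *: P + al *: (1%:M - P)) *m U' *m (al *: P + be *: (1%:M - P)).
Proof.
rewrite HDt HQ HU' HP HA HU /k !mxs.
by congr mx2; field: HI Hr.
Qed.

End DressingAlgebra.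

(** * Hermitian projections *)

Section Projection.
Context {R : realType}.
Notation C := R[i].

Definition sqnorm (y : 'cV[C]_2) : C := `|y 0 0| ^+ 2 + `|y 1 0| ^+ 2.

Lemma sqnormE (y : 'cV[C]_2) : sqnorm y = y 0 0 * (y 0 0)^* + y 1 0 * (y 1 0)^*.
Proof. by rewrite /sqnorm !normCK. Qed.

Lemma sqnorm_real (y : 'cV[C]_2) : sqnorm y =
  ((complex.Re (y 0 0) ^+ 2 + complex.Im (y 0 0) ^+ 2 +
    (complex.Re (y 1 0) ^+ 2 + complex.Im (y 1 0) ^+ 2))%:C)%C.
Proof. by rewrite /sqnorm -!add_Re2_Im2 -rmorphD. Qed.

Lemma sqnorm_neq0 (y : 'cV[C]_2) : y != 0 -> sqnorm y != 0.
Proof.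
apply: contra; rewrite paddr_eq0 ?exprn_ge0 // !expf_eq0 /= !normr_eq0.
move=> /andP[/eqP y0 /eqP y1]; apply/eqP/matrixP => i j; rewrite (ord1 j) mxE.
by move: i; exact: forall_ord2.
Qed.

Lemma herm_proj_ontoK (y : 'cV[C]_2) (p : 'M[C]_2) :
  herm_proj_onto y p -> p *m y = y.
Proof.
case=> _ pp im; have [w yw] : exists w, y = p *m w.
  by apply/im; exists 1; rewrite scale1r.
by rewrite {1}yw mulmxA pp -yw.
Qed.

(** Column [j] lies in the image, so it is [c y]; conjugating entry [j] of [p y = y] gives
    [conj (y j) = c |y|^2]. Thus [p = y y^* / |y|^2]. *)
Lemma herm_proj_ontoE (y : 'cV[C]_2) (p : 'M[C]_2) i j : y != 0 ->
  herm_proj_onto y p -> p i j = y i 0 * (y j 0)^* / sqnorm y.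
Proof.
move=> y0 H; have py := herm_proj_ontoK H; case: H => pJ _ im.
have [c Ec] : exists c, col j p = c *: y.
  by apply/im; exists (delta_mx j 0); rewrite colE.
have Ec' k : p k j = c * y k 0 by have /matrixP/(_ k 0) := Ec; rewrite !mxE.
have pJ' k l : (p l k)^* = p k l by have /matrixP/(_ k l) := pJ; rewrite !mxE.
have yj : (y j 0)^* = c * sqnorm y.
  have /matrixP/(_ j 0) := py; rewrite mulmx2E => <-.
  by rewrite rmorphD !rmorphM /= !pJ' !Ec' sqnormE; ring.
by rewrite Ec' yj mulrA mulfK ?sqnorm_neq0 // mulrC.
Qed.

Lemma herm_proj_onto_outer (y : 'cV[C]_2) (p : 'M[C]_2) : y != 0 ->
  herm_proj_onto y p -> p = y *m ((sqnorm y)^-1 *: y^t*).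
Proof.
move=> y0 H; apply/matrixP => i j; rewrite (herm_proj_ontoE _ _ y0 H).
by rewrite mxE big_ord1 !mxE; ring.
Qed.

(** The projection has trace 1, and entry [(0, 0)] of [p^2 = p] is the quadratic relation. These are
    the hypotheses [HP] and [Hr] of the dressing identities. *)
Lemma herm_proj_onto_mx2 (y : 'cV[C]_2) (p : 'M[C]_2) : y != 0 ->
  herm_proj_onto y p ->
  p = mx2 (p 0 0) (p 0 1) (p 0 1)^* (1 - p 0 0) /\
  p 0 0 * p 0 0 = p 0 0 - p 0 1 * (p 0 1)^*.
Proof.
move=> y0 H; have E := herm_proj_ontoE _ _ y0 H; case: H => pJ pp _.
have pJ' k l : (p l k)^* = p k l by have /matrixP/(_ k l) := pJ; rewrite !mxE.
have N0 := sqnorm_neq0 y0.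
have tr1 : p 0 0 + p 1 1 = 1.
  by rewrite !E -mulrDl -sqnormE divff.
split.
  by apply: mx2_eq; rewrite mx2E ?pJ' // -tr1 addrC addKr.
have /matrixP/(_ 0 0) := pp; rewrite mulmx2E -(pJ' 1 0) => E00.
by apply: (addIr (p 0 1 * (p 0 1)^*)); rewrite E00 subrK.
Qed.

(** [p y = y] gives [D y = - (1 - p) A y], hence [D p]; its adjoint is [p D], and
    [D = D p + p D]. *)
Lemma mderive_herm_proj (p : R -> 'M[C]_2) (y : R -> 'cV[C]_2) (s : R) A D :
  (forall r, y r != 0) -> (forall r, herm_proj_onto (y r) (p r)) ->
  mderive y s (- (A *m y s)) -> mderive p s D ->
  D^t* = D /\ D = - (p s *m A^t* *m (1%:M - p s)) - (1%:M - p s) *m A *m p s.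
Proof.
move=> y0 H Dy Dp.
have pJ r : (p r)^t* = p r by case: (H r).
have pp r : p r *m p r = p r by case: (H r).
have DJ : D^t* = D.
  by apply: mderive_uniq (mderive_congr pJ (mderiveJ Dp)) Dp.
have Dpp : D *m p s + p s *m D = D.
  by apply: mderive_uniq (mderive_congr pp (mderiveM Dp Dp)) Dp.
have Dpy : D *m y s + p s *m - (A *m y s) = - (A *m y s).
  apply: mderive_uniq (mderive_congr _ (mderiveM Dp Dy)) Dy => r.
  exact: herm_proj_ontoK (H r).
have {Dpy}Dpy : D *m y s = - ((1%:M - p s) *m A *m y s).
  rewrite -[LHS](addrK (p s *m - (A *m y s))) Dpy !mulmxBl mul1mx mulmxN opprK.
  by rewrite opprB addrC mulmxA.
have Dps : D *m p s = - ((1%:M - p s) *m A *m p s).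
  (* [p] is [y] times a row, so what is known of [D y] passes to [D p]. *)
  have Ep := herm_proj_onto_outer (y0 s) (H s).
  move: (_ *: _) Ep => w Ep.
  have -> : D *m p s = D *m y s *m w by rewrite -mulmxA -Ep.
  by rewrite Dpy mulNmx -(mulmxA _ (y s) w) -Ep.
have pDs : p s *m D = - (p s *m A^t* *m (1%:M - p s)).
  rewrite -[LHS]mxJK mulmxJ pJ DJ Dps; apply/matrixP => i j.
  have E : ((1%:M - p s) *m A *m p s)^t* = p s *m A^t* *m (1%:M - p s).
    rewrite !mulmxJ pJ mulmxA; congr (_ *m _).
    by rewrite linearB /= rmorphB /= pJ trmx1 map_mx1.
  by rewrite -E !mxE rmorphN.
by split=> //; rewrite -[LHS]Dpp Dps pDs addrC.
Qed.

Lemma msmooth_herm_proj (p : R -> R -> 'M[C]_2) (y : R -> R -> 'cV[C]_2) :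
  (forall x t, y x t != 0) -> (forall x t, herm_proj_onto (y x t) (p x t)) ->
  msmooth y -> msmooth p.
Proof.
move=> y0 H sy.
have -> : p = fun x t => y x t *m ((sqnorm (y x t))^-1 *: (y x t)^t*).
  apply/funext => x; apply/funext => t.
  exact: herm_proj_onto_outer (y0 x t) (H x t).
apply: msmoothM => //; apply: msmoothZ; last exact: msmoothJ.
pose n x t := complex.Re (y x t 0 0) ^+ 2 + complex.Im (y x t 0 0) ^+ 2 +
    (complex.Re (y x t 1 0) ^+ 2 + complex.Im (y x t 1 0) ^+ 2).
have -> : (fun x t => (sqnorm (y x t))^-1) = fun x t => (((n x t)^-1)%:C)%C.
  by apply/funext => x; apply/funext => t; rewrite sqnorm_real -fmorphV.
apply: csmooth_real; apply: smoothV => [x t|].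
  apply: contra (sqnorm_neq0 (y0 x t)) => /eqP E.
  by rewrite sqnorm_real -/(n x t) E.
have [a b] := sy 0 0; have [c d] := sy 1 0.
by apply: smoothD; apply: smoothD; exact: smoothM.
Qed.

(** The simple factor is 1 on the image of [p] and [(l - conj alpha) / (l - alpha)] on that of
    [1 - p]; only this scalar is inverted. *)
Lemma invmx_simple_factor (alpha : C) (p : 'M[C]_2) (l : C) :
  p *m p = p -> l != alpha -> l != alpha^* ->
  invmx (simple_factor alpha p l) =
  p + ((l - alpha) / (l - alpha^*)) *: (1%:M - p).
Proof.
move=> pp la lb; set h := RHS.
have p'p' : (1%:M - p) *m (1%:M - p) = 1%:M - p.
  by rewrite mulmxBr mulmx1 mulmxBl mul1mx pp subrr subr0.
have p'p : (1%:M - p) *m p = 0 by rewrite mulmxBl mul1mx pp subrr.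
have E : simple_factor alpha p l *m h = 1%:M.
  rewrite /simple_factor /h mulmxDl mul1mx mulmxDr -!scalemxAl p'p scaler0 add0r.
  rewrite -scalemxAr p'p' scalerA -addrA -scalerDl.
  have -> : (l - alpha) / (l - alpha^*) + (alpha - alpha^*) / (l - alpha) *
      ((l - alpha) / (l - alpha^*)) = 1.
    by field; rewrite !subr_eq0 la lb.
  by rewrite scale1r addrC subrK.
have [u _] := mulmx1_unit E.
by rewrite -[LHS]mulmx1 -E mulmxA mulVmx // mul1mx.
Qed.

End Projection.

(** * The dressed frame *)

Section ComplexDerivability.

Lemma near_neq (K : numFieldType) (l a : K) : l != a -> \forall z \near (l : K^o), z != a.
Proof.
move=> la; apply/nbhs_normP; exists `|l - a|; first by rewrite /= normr_gt0 subr_eq0.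
by move=> z /=; apply: contraTN => /eqP ->; rewrite ltxx.
Qed.
Lemma derivable_atD (K : numFieldType) (f g : K -> K) l :
  derivable_at f l -> derivable_at g l -> derivable_at (fun z => f z + g z) l.
Proof. exact: derivableD. Qed.
Lemma derivable_atM (K : numFieldType) (f g : K -> K) l :
  derivable_at f l -> derivable_at g l -> derivable_at (fun z => f z * g z) l.
Proof. exact: derivableM. Qed.
Lemma derivable_at_cst (K : numFieldType) (c : K) l : derivable_at (fun _ : K => c) l.
Proof. exact: derivable_cst. Qed.
Lemma derivable_at_id (K : numFieldType) (l : K) : derivable_at (fun z : K => z) l.
Proof. exact: derivable_id. Qed.
Lemma derivable_atV (K : numFieldType) (f : K -> K) l :
  f l != 0 -> derivable_at f l -> derivable_at (fun z => (f z)^-1) l.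
Proof. exact: derivableV. Qed.
Lemma derivable_at_near (K : numFieldType) (f g : K -> K) (l : K) :
  (\forall z \near (l : K^o), f z = g z) -> derivable_at f l -> derivable_at g l.
Proof. exact: near_eq_derivable. Qed.

End ComplexDerivability.

(** * Frames with exceptional spectral values and their reality condition *)

Section FrameOff.
Context {R : realType}.
Notation C := R[i].
Implicit Types (q : R -> R -> C) (E : R -> R -> C -> 'M[C]_2) (S : seq C).

Definition laxA q x t (l : C) : 'M[C]_2 := l *: su_a + lax_u q x t.

Definition laxB q x t (l : C) : 'M[C]_2 :=
  l ^+ 2 *: su_a + l *: lax_u q x t + lax_Q q x t.

Lemma mxZJ m n (c : C) (M : 'M[C]_(m, n)) : (c *: M)^t* = c^* *: M^t*.
Proof. by apply/matrixP => i j; rewrite !mxE rmorphM. Qed.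

Lemma mxDJ m n (M N : 'M[C]_(m, n)) : (M + N)^t* = M^t* + N^t*.
Proof. by apply/matrixP => i j; rewrite !mxE rmorphD. Qed.

Lemma su_aJ : su_a^t* = - su_a :> 'M[C]_2.
Proof. by have := su2_ofJ (@dvec R 0); rewrite -deltaE. Qed.

(** The infinitesimal form of [E(conj l)^* E(l) = 1]. It lets the adjoint of [A(alpha)] be replaced
    by [- A(conj alpha)] in the equation for [p]. *)
Lemma laxAJ q x t l : (laxA q x t l^*)^t* = - laxA q x t l.
Proof.
by rewrite /laxA mxDJ mxZJ conjCK su_aJ lax_uE su2_ofJ scalerN -opprD.
Qed.

Lemma laxBJ q x t l : (laxB q x t l^*)^t* = - laxB q x t l.
Proof.
rewrite /laxB lax_uE lax_QE.
move: (su2_ofJ (uvec q x t)) (su2_ofJ (Qvec q x t)) su_aJ.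
move: (su2_of _) (su2_of _) su_a => U Q A UJ QJ AJ.
rewrite !mxDJ !mxZJ UJ QJ AJ conjCK rmorphXn /= conjCK.
by rewrite !scalerN -!opprD.
Qed.

Lemma frame_off_unitary S q E l x t : frame_off S q E -> l \notin S ->
  (E x t l^*)^t* *m E x t l = 1%:M.
Proof. by move=> HE /HE[_ _ /(_ x t)[]]. Qed.

Lemma frame_off_invmx S q E l x t : frame_off S q E -> l \notin S ->
  invmx (E x t l) = (E x t l^*)^t*.
Proof.
move=> HE lS; have U := frame_off_unitary x t HE lS.
have [_ Eu] := mulmx1_unit U.
by rewrite -[LHS]mul1mx -U -mulmxA mulmxV // mulmx1.
Qed.

Lemma frame_off_mpdx S q E l x t : frame_off S q E -> l \notin S ->
  mpdx (fun x t => E x t l) x t = E x t l *m laxA q x t l.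
Proof.
move=> HE /HE[_ _ /(_ x t)[Eu _] /(_ x t) Hx _].
by rewrite /laxA -Hx mulmxA mulmxV // mul1mx.
Qed.

Lemma frame_off_mpdt S q E l x t : frame_off S q E -> l \notin S ->
  mpdt (fun x t => E x t l) x t = E x t l *m laxB q x t l.
Proof.
move=> HE /HE[_ _ /(_ x t)[Eu _] _ /(_ x t) Ht].
by rewrite /laxB -Ht mulmxA mulmxV // mul1mx.
Qed.

Lemma frame_off_dx S q E l x t : frame_off S q E -> l \notin S ->
  mderive (fun r => E r t l) x (E x t l *m laxA q x t l).
Proof.
move=> HE lS; rewrite -(frame_off_mpdx x t HE lS).
by case: (HE l lS) => sE _ _ _ _; exact: (msmooth_mderive_x x t sE).
Qed.

Lemma frame_off_dt S q E l x t : frame_off S q E -> l \notin S ->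
  mderive (fun r => E x r l) t (E x t l *m laxB q x t l).
Proof.
move=> HE lS; rewrite -(frame_off_mpdt x t HE lS).
by case: (HE l lS) => sE _ _ _ _; exact: (msmooth_mderive_t x t sE).
Qed.

Lemma lax_frame_of_frame_off S q E : frame_off S q E -> 0 \notin S ->
  lax_frame q (fun x t => E x t 0).
Proof.
move=> HE S0; split.
- by case: (HE 0 S0).
- by move=> x t; have := frame_off_unitary x t HE S0; rewrite conjC0.
- move=> x t; rewrite (frame_off_mpdx x t HE S0).
  by rewrite /laxA scale0r add0r.
- move=> x t; rewrite (frame_off_mpdt x t HE S0).
  by rewrite /laxB expr2 mul0r !scale0r !add0r.
Qed.

End FrameOff.

(** * Derivative of the corrected curve *)

Section SymFormula.
Context {R : realType}.
Notation C := R[i].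

Lemma mxBJ m n (M N : 'M[C]_(m, n)) : (M - N)^t* = M^t* - N^t*.
Proof. by apply/matrixP => i j; rewrite !mxE rmorphB. Qed.

Lemma mx1J n : (1%:M : 'M[C]_n)^t* = 1%:M.
Proof. by rewrite trmx1 map_mx1. Qed.

Lemma mulmx_factor n (A B B' D F : 'M[C]_n) :
  B *m B' + D = F -> A *m B *m B' + A *m D = A *m F.
Proof. by move=> <-; rewrite mulmxDr mulmxA. Qed.

Lemma scale_pull (F : fieldType) (V : lmodType F) (a b : F) (u v : V) :
  b != 0 -> u + (a / b) *: v = b^-1 *: (b *: u + a *: v).
Proof. by move=> b0; rewrite scalerDr !scalerA mulVf // scale1r mulrC. Qed.

(** The scalar [c] drops out of the commutator with [W], so the shift by half the identity does not
    affect the velocity; dividing the hypothesis by [|alpha|^2] gives the claim. *)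
Lemma sym_value (alpha : C) (phi P W T T' D : 'M[C]_2) (c : C) :
  alpha != 0 -> W^t* = - W -> P^t* = P ->
  (alpha * alpha^*) *: T -
    (alpha - alpha^*) *: (W *m P - P *m W + D) =
  (alpha^* *: P + alpha *: (1%:M - P)) *m T' *m
    (alpha *: P + alpha^* *: (1%:M - P)) ->
  let phi' := phi *m (P + (alpha / alpha^*) *: (1%:M - P)) in
  phi *m T *m phi^t* - ((alpha - alpha^*) / `|alpha| ^+ 2) *:
    ((phi *m W *m (P - c *: 1%:M) + phi *m D) *m phi^t* +
     phi *m (P - c *: 1%:M) *m (phi *m W)^t*) = phi' *m T' *m phi'^t*.
Proof.
move=> a0 WJ PJ H phi'.
have b0 : alpha^* != 0 by rewrite conjC_eq0.
have ab0 : alpha * alpha^* != 0 by rewrite mulf_neq0.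
have -> : phi'^t* = (P + (alpha^* / alpha) *: (1%:M - P)) *m phi^t*.
  rewrite /phi' mulmxJ mxDJ mxZJ mxBJ mx1J PJ.
  by rewrite rmorphM fmorphV /= conjCK.
rewrite /phi' mulmxDl addrAC conj_commutator // -mulmxDl -mulmxDr.
have -> : W *m (P - c *: 1%:M) - (P - c *: 1%:M) *m W = W *m P - P *m W.
  rewrite mulmxBr mulmxBl -scalemxAr -scalemxAl mulmx1 mul1mx.
  by rewrite opprB addrA subrK.
have E1 := scale_pull alpha P (1%:M - P) b0.
have E2 := scale_pull alpha^* P (1%:M - P) a0.
have E3 : phi *m (P + (alpha / alpha^*) *: (1%:M - P)) *m T' *m
    ((P + (alpha^* / alpha) *: (1%:M - P)) *m phi^t*) =
    phi *m ((alpha * alpha^*)^-1 *: ((alpha^* *: P + alpha *: (1%:M - P)) *m T' *m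
      (alpha *: P + alpha^* *: (1%:M - P)))) *m phi^t*.
  rewrite E1 E2; move: (alpha^* *: P + _) (alpha *: P + _) => X Y.
  rewrite -!scalemxAr -!scalemxAl -!scalemxAr scalerA invfM !mulmxA.
  by rewrite [alpha^-1 * _]mulrC.
rewrite E3 -H normCK scalerBr !scalerA mulVf // scale1r.
rewrite [(alpha * alpha^*)^-1 * _]mulrC mulmxBr mulmxBl.
by rewrite -scalemxAr -scalemxAl.
Qed.

(** One statement for both variables: [(W, T, T')] is [(u, a, a)] in x, and [(Q, u, dressed u)] in
    t. *)
Lemma mderive_sym (alpha : C) (phi p X : R -> 'M[C]_2) (s : R) W T T' D :
  alpha != 0 -> (forall r, (phi r)^t* *m phi r = 1%:M) ->
  mderive phi s (phi s *m W) -> W^t* = - W ->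
  mderive p s D -> (p s)^t* = p s ->
  mderive X s (phi s *m T *m (phi s)^t*) ->
  (alpha * alpha^*) *: T -
    (alpha - alpha^*) *: (W *m p s - p s *m W + D) =
  (alpha^* *: p s + alpha *: (1%:M - p s)) *m T' *m
    (alpha *: p s + alpha^* *: (1%:M - p s)) ->
  let phi' := phi s *m (p s + (alpha / alpha^*) *: (1%:M - p s)) in
  mderive (fun r => X r - ((alpha - alpha^*) / `|alpha| ^+ 2) *:
    (phi r *m (p r - 2^-1 *: 1%:M) *m invmx (phi r))) s (phi' *m T' *m phi'^t*).
Proof.
move=> a0 U Dphi WJ Dp PJ DX H phi'.
have Dpst := mderiveB Dp (mderive_cst (2^-1 *: 1%:M) s).
have D1 := mderiveB DX (mderiveZc ((alpha - alpha^*) / `|alpha| ^+ 2)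
  (mderiveM (mderiveM Dphi Dpst) (mderiveJ Dphi))).
apply: mderive_congr (mderive_eq D1 _) => [r|].
  by rewrite unitary_invmx.
by rewrite subr0; exact: sym_value.
Qed.

End SymFormula.

(** * Dressing a frame by a simple factor *)

Section Dressing.
Context {R : realType}.
Notation C := R[i].
Variables (q : R -> R -> C) (E : R -> R -> C -> 'M[C]_2).
Variables (alpha : C) (v0 : 'cV[C]_2) (p : R -> R -> 'M[C]_2).
Hypothesis E_frame : frame_off [::] q E.
Hypothesis alpha_nonreal : alpha != alpha^*.
Hypothesis v0_neq0 : v0 != 0.
Hypothesis p_proj : forall x t, herm_proj_onto (invmx (E x t alpha) *m v0) (p x t).

Let y x t := invmx (E x t alpha) *m v0.
Let notin0 (l : C) : l \notin [::] := isT.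

(** Trading the inverse at [alpha] for an adjoint at [conj alpha] makes smoothness and derivatives
    of [y] immediate. *)
Lemma dressing_yE x t : y x t = (E x t alpha^*)^t* *m v0.
Proof. by rewrite /y (frame_off_invmx _ _ E_frame (notin0 alpha)). Qed.

Lemma dressing_y_neq0 x t : y x t != 0.
Proof.
have [_ _ /(_ x t)[Eu _] _ _] := E_frame (notin0 alpha).
apply: contra v0_neq0 => /eqP Y.
by rewrite -[v0]mul1mx -(mulmxV Eu) -mulmxA -/(y x t) Y mulmx0.
Qed.

Lemma dressing_y_smooth : msmooth y.
Proof.
have -> : y = fun x t => (E x t alpha^*)^t* *m v0.
  by apply/funext => x; apply/funext => t; exact: dressing_yE.
have [sE _ _ _ _] := E_frame (notin0 alpha^*).
by apply: msmoothM; [exact: msmoothJ | exact: msmooth_const].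
Qed.

Lemma dressing_p_smooth : msmooth p.
Proof. exact: msmooth_herm_proj dressing_y_neq0 p_proj dressing_y_smooth. Qed.

(** [f] is a coordinate line, [(r, t)] or [(x, r)], so that one proof serves both variables. *)
Lemma dressing_y_mderive (f : R -> R * R) s (A : C -> 'M[C]_2) :
  (forall l, (A l^*)^t* = - A l) ->
  mderive (fun r => E (f r).1 (f r).2 alpha^*) s
    (E (f s).1 (f s).2 alpha^* *m A alpha^*) ->
  mderive (fun r => y (f r).1 (f r).2) s (- (A alpha *m y (f s).1 (f s).2)).
Proof.
move=> AJ D.
apply: (@mderive_congr _ _ _ (fun r => (E (f r).1 (f r).2 alpha^*)^t* *m v0)).
  by move=> r; rewrite dressing_yE.
apply: mderive_eq (mderiveM (mderiveJ D) (mderive_cst v0 s)) _.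
by rewrite mulmx0 addr0 dressing_yE mulmxJ AJ !mulNmx mulmxA.
Qed.

Lemma dressing_p_mderive (f : R -> R * R) s (A : C -> 'M[C]_2) D :
  (forall l, (A l^*)^t* = - A l) ->
  mderive (fun r => E (f r).1 (f r).2 alpha^*) s
    (E (f s).1 (f s).2 alpha^* *m A alpha^*) ->
  mderive (fun r => p (f r).1 (f r).2) s D ->
  let P := p (f s).1 (f s).2 in
  D^t* = D /\ D = P *m A alpha^* *m (1%:M - P) - (1%:M - P) *m A alpha *m P.
Proof.
move=> AJ DE Dp P.
have AJ' : (A alpha)^t* = - A alpha^* by rewrite -AJ conjCK.
have [DJ ED] := mderive_herm_proj (fun r => dressing_y_neq0 (f r).1 (f r).2)
  (fun r => p_proj (f r).1 (f r).2) (dressing_y_mderive AJ DE) Dp.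
by split; [exact: DJ | rewrite ED AJ' mulmxN mulNmx opprK].
Qed.

Definition dressed_q x t : C := q x t + 2 * 'i%C * (alpha - alpha^*) *
  (y x t 0 0 * (y x t 1 0)^* / (`|y x t 0 0| ^+ 2 + `|y x t 1 0| ^+ 2)).

Let s x t := p x t 0 1.
Let k : C := 2 * 'i%C * (alpha - alpha^*).

Lemma dressed_qE : dressed_q = fun x t => q x t + k * s x t.
Proof.
apply/funext => x; apply/funext => t.
by rewrite /s (herm_proj_ontoE _ _ (dressing_y_neq0 x t) (p_proj x t)).
Qed.

Lemma lax_frame_q : lax_frame q (fun x t => E x t 0).
Proof. exact: lax_frame_of_frame_off E_frame (notin0 0). Qed.

Lemma dressing_p_dx x t : (mpdx p x t)^t* = mpdx p x t /\
  mpdx p x t = p x t *m laxA q x t alpha^* *m (1%:M - p x t) -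
    (1%:M - p x t) *m laxA q x t alpha *m p x t.
Proof.
exact: (@dressing_p_mderive (fun r => (r, t)) x (laxA q x t) (mpdx p x t)
  (laxAJ q x t) (frame_off_dx x t E_frame (notin0 alpha^*))
  (msmooth_mderive_x x t dressing_p_smooth)).
Qed.

Lemma dressing_p_dt x t : (mpdt p x t)^t* = mpdt p x t /\
  mpdt p x t = p x t *m laxB q x t alpha^* *m (1%:M - p x t) -
    (1%:M - p x t) *m laxB q x t alpha *m p x t.
Proof.
exact: (@dressing_p_mderive (fun r => (x, r)) t (laxB q x t) (mpdt p x t)
  (laxBJ q x t) (frame_off_dt x t E_frame (notin0 alpha^*))
  (msmooth_mderive_t x t dressing_p_smooth)).
Qed.

(** Both [i] and [alpha - conj alpha] are imaginary, so [k] is real. Hence the matrix [U'] of the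
    dressing identities has the shape of [lax_u]. *)
Lemma dressing_coef_conj : k^* = k.
Proof.
have iJ : ('i%C : C)^* = - 'i%C.
  by rewrite conjCE /=; apply/eqP; rewrite eq_complex /= oppr0 !eqxx.
rewrite /k !rmorphM rmorphB /= conjCK iJ conjC_nat.
by rewrite mulrN mulNr -mulrN opprB.
Qed.

Lemma conj_add_dressing_coef (a b : C) : (a + k * b)^* = a^* + k * b^*.
Proof. by rewrite rmorphD rmorphM /= dressing_coef_conj. Qed.

Lemma cpdx_dressed_q x t :
  cpdx dressed_q x t = cpdx q x t + k * mpdx p x t 0 1.
Proof.
have sq := csmooth_of_lax_frame lax_frame_q.
have Dq := csmooth_cderive_x x t sq.
have Ds : cderive (s ^~ t) x (mpdx p x t 0 1).
  exact: (msmooth_mderive_x x t dressing_p_smooth 0 1).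
rewrite dressed_qE; apply: cderive_cpdx.
apply: cderive_eq (cderiveD Dq (cderiveM (cderive_cst k x) Ds)) _.
by rewrite mul0r add0r.
Qed.

Lemma lax_u_mx2 (f : R -> R -> C) x t :
  lax_u f x t = mx2 0 (f x t) (- (f x t)^*) 0.
Proof. by []. Qed.

Lemma lax_Q_mx2 (f : R -> R -> C) x t : lax_Q f x t = ('i%C / 2) *:
  mx2 (- (f x t * (f x t)^*)) (cpdx f x t) (cpdx f x t)^* (f x t * (f x t)^*).
Proof. by rewrite /lax_Q normCK. Qed.

Lemma lax_u_dressed x t : lax_u dressed_q x t =
  mx2 0 (q x t + k * s x t) (- ((q x t)^* + k * (s x t)^*)) 0.
Proof. by rewrite lax_u_mx2 dressed_qE conj_add_dressing_coef. Qed.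

Lemma lax_Q_dressed x t : lax_Q dressed_q x t = ('i%C / 2) *:
  mx2 (- ((q x t + k * s x t) * ((q x t)^* + k * (s x t)^*)))
      (cpdx q x t + k * mpdx p x t 0 1)
      ((cpdx q x t)^* + k * mpdx p x t 1 0)
      ((q x t + k * s x t) * ((q x t)^* + k * (s x t)^*)).
Proof.
have E01 : (mpdx p x t 0 1)^* = mpdx p x t 1 0.
  have [DJ _] := dressing_p_dx x t; rewrite -[in RHS]DJ.
  by move: (mpdx p x t) => D; rewrite !mxE.
rewrite lax_Q_mx2 cpdx_dressed_q.
by rewrite conj_add_dressing_coef E01 dressed_qE conj_add_dressing_coef.
Qed.

Let i_sqr : 'i%C * 'i%C = -1 :> C.
Proof. by rewrite -expr2 sqr_i. Qed.

Let p_mx2 x t : p x t = mx2 (p x t 0 0) (s x t) (s x t)^* (1 - p x t 0 0).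
Proof. by have [] := herm_proj_onto_mx2 (dressing_y_neq0 x t) (p_proj x t). Qed.

Let p_sqr x t : p x t 0 0 * p x t 0 0 = p x t 0 0 - s x t * (s x t)^*.
Proof. by have [] := herm_proj_onto_mx2 (dressing_y_neq0 x t) (p_proj x t). Qed.

Let Dx x t := (dressing_p_dx x t).2.
Let Dt x t := (dressing_p_dt x t).2.

(* The inverse of the simple factor at [l]. *)
Definition dressing_factor x t l : 'M[C]_2 :=
  p x t + ((l - alpha) / (l - alpha^*)) *: (1%:M - p x t).

(** Division of the polynomial identities by [l - conj alpha]; the scalar before [D] is
    [(alpha - conj alpha) / (l - conj alpha)], the coefficient of [p] in [h]. *)
Let factor_scale x t l (A A' D : 'M[C]_2) : l != alpha^* ->
  A *m ((l - alpha^*) *: p x t + (l - alpha) *: (1%:M - p x t)) +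
    (alpha - alpha^*) *: D =
  ((l - alpha^*) *: p x t + (l - alpha) *: (1%:M - p x t)) *m A' ->
  A *m dressing_factor x t l + (1 - (l - alpha) / (l - alpha^*)) *: D =
  dressing_factor x t l *m A'.
Proof.
move=> lb; have lb0 : l - alpha^* != 0 by rewrite subr_eq0.
have -> : dressing_factor x t l = (l - alpha^*)^-1 *:
    ((l - alpha^*) *: p x t + (l - alpha) *: (1%:M - p x t)).
  exact: scale_pull.
have -> : 1 - (l - alpha) / (l - alpha^*) =
    (l - alpha^*)^-1 * (alpha - alpha^*) by field.
by move=> H; rewrite -scalemxAr -scalerA -scalerDr H scalemxAl.
Qed.

Lemma dressing_factor_dx x t l : l != alpha^* ->
  laxA q x t l *m dressing_factor x t l +
    (1 - (l - alpha) / (l - alpha^*)) *: mpdx p x t =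
  dressing_factor x t l *m laxA dressed_q x t l.
Proof.
move=> lb; apply: factor_scale => //.
exact: (dressing_x i_sqr (p_sqr x t) (p_mx2 x t) su_aE (lax_u_mx2 q x t)
  (Dx x t) (lax_u_dressed x t)).
Qed.

Lemma dressing_factor_dt x t l : l != alpha^* ->
  laxB q x t l *m dressing_factor x t l +
    (1 - (l - alpha) / (l - alpha^*)) *: mpdt p x t =
  dressing_factor x t l *m laxB dressed_q x t l.
Proof.
move=> lb; apply: factor_scale => //.
exact: (dressing_t i_sqr (p_sqr x t) (p_mx2 x t) su_aE (lax_u_mx2 q x t)
  (lax_Q_mx2 q x t) (Dx x t) (Dt x t) (lax_u_dressed x t) (lax_Q_dressed x t)).
Qed.

Lemma dressing_sym_x x t :
  (alpha * alpha^*) *: su_a - (alpha - alpha^*) *: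
    (lax_u q x t *m p x t - p x t *m lax_u q x t + mpdx p x t) =
  (alpha^* *: p x t + alpha *: (1%:M - p x t)) *m su_a *m
    (alpha *: p x t + alpha^* *: (1%:M - p x t)).
Proof.
exact: (sym_x i_sqr (p_sqr x t) (p_mx2 x t) su_aE (lax_u_mx2 q x t) (Dx x t)).
Qed.

Lemma dressing_sym_t x t :
  (alpha * alpha^*) *: lax_u q x t - (alpha - alpha^*) *:
    (lax_Q q x t *m p x t - p x t *m lax_Q q x t + mpdt p x t) =
  (alpha^* *: p x t + alpha *: (1%:M - p x t)) *m lax_u dressed_q x t *m
    (alpha *: p x t + alpha^* *: (1%:M - p x t)).
Proof.
exact: (sym_t i_sqr (p_sqr x t) (p_mx2 x t) su_aE (lax_u_mx2 q x t)
  (lax_Q_mx2 q x t) (Dt x t) (lax_u_dressed x t)).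
Qed.

Definition dressed_E x t l : 'M[C]_2 :=
  E x t l *m invmx (simple_factor alpha (p x t) l).

Lemma dressed_E_factor x t l : l != alpha -> l != alpha^* ->
  dressed_E x t l = E x t l *m dressing_factor x t l.
Proof.
by move=> la lb; rewrite /dressed_E invmx_simple_factor //; case: (p_proj x t).
Qed.

Let conj_neq (l m : C) : l != m^* -> l^* != m.
Proof. by apply: contra => /eqP <-; rewrite conjCK. Qed.

(** Replacing [l] by its conjugate and conjugating inverts the scalar
    [(l - alpha) / (l - conj alpha)], while [p] and [1 - p] are orthogonal Hermitian projections. *)
Lemma dressing_factor_unitary x t l : l != alpha -> l != alpha^* ->
  (dressing_factor x t l^*)^t* *m dressing_factor x t l = 1%:M.
Proof.
move=> la lb; have [pJ pp _] := p_proj x t.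
have p'p' : (1%:M - p x t) *m (1%:M - p x t) = 1%:M - p x t.
  by rewrite mulmxBr mulmx1 mulmxBl mul1mx pp subrr subr0.
have p'p : (1%:M - p x t) *m p x t = 0 by rewrite mulmxBl mul1mx pp subrr.
have pp' : p x t *m (1%:M - p x t) = 0 by rewrite mulmxBr mulmx1 pp subrr.
rewrite /dressing_factor mxDJ mxZJ mxBJ mx1J pJ rmorphM fmorphV !rmorphB /=.
rewrite !conjCK mulmxDl !mulmxDr pp -!scalemxAr -!scalemxAl pp' p'p p'p'.
rewrite !scaler0 addr0 add0r scalerA.
have -> : (l - alpha) / (l - alpha^*) * ((l - alpha^*) / (l - alpha)) = 1.
  by field; rewrite !subr_eq0 la lb.
by rewrite scale1r addrC subrK.
Qed.

(** The exceptional values are those where the simple factor has its pole, [alpha], and where it is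
    singular, [conj alpha]. *)
Lemma dressed_frame : frame_off [:: alpha; alpha^*] dressed_q dressed_E.
Proof.
move=> l; rewrite !inE negb_or => /andP[la lb].
have [sE dE _ _ _] := E_frame (notin0 l).
have EE : (fun x t => dressed_E x t l) =
    fun x t => E x t l *m dressing_factor x t l.
  by apply/funext => x; apply/funext => t; exact: dressed_E_factor.
have U x t : (dressed_E x t l^*)^t* *m dressed_E x t l = 1%:M.
  have la' : l^* != alpha by apply: conj_neq.
  have lb' : l^* != alpha^* by apply: conj_neq; rewrite conjCK.
  rewrite !dressed_E_factor // mulmxJ -mulmxA (mulmxA _ (E x t l)).
  rewrite (frame_off_unitary x t E_frame (notin0 l)) mul1mx.
  exact: dressing_factor_unitary.
have Eu x t : dressed_E x t l \in unitmx by case/mulmx1_unit: (U x t).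
have Dfac (f : R -> R * R) r D : mderive (fun r => p (f r).1 (f r).2) r D ->
    mderive (fun r => dressing_factor (f r).1 (f r).2 l) r
      ((1 - (l - alpha) / (l - alpha^*)) *: D).
  move=> Dp; have D1 := mderiveB (mderive_cst (1%:M : 'M[C]_2) r) Dp.
  apply: mderive_eq (mderiveD Dp (mderiveZc _ D1)) _.
  by rewrite sub0r scalerN scalerBl scale1r.
split; last 2 first.
- move=> x t; rewrite -[RHS](mulKmx (Eu x t)); congr (_ *m _).
  apply: mderive_mpdx; apply: (@mderive_congr _ _ _
    (fun r => E r t l *m dressing_factor r t l)).
    by move=> r; rewrite dressed_E_factor.
  apply: mderive_eq (mderiveM (frame_off_dx x t E_frame (notin0 l))
    (Dfac (fun r => (r, t)) x _ (msmooth_mderive_x x t dressing_p_smooth))) _.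
  rewrite dressed_E_factor //.
  exact: etrans (mulmx_factor _ (dressing_factor_dx x t lb)) (mulmxA _ _ _).
- move=> x t; rewrite -[RHS](mulKmx (Eu x t)); congr (_ *m _).
  apply: mderive_mpdt; apply: (@mderive_congr _ _ _
    (fun r => E x r l *m dressing_factor x r l)).
    by move=> r; rewrite dressed_E_factor.
  apply: mderive_eq (mderiveM (frame_off_dt x t E_frame (notin0 l))
    (Dfac (fun r => (x, r)) t _ (msmooth_mderive_t x t dressing_p_smooth))) _.
  rewrite dressed_E_factor //.
  exact: etrans (mulmx_factor _ (dressing_factor_dt x t lb)) (mulmxA _ _ _).
- rewrite EE; apply: msmoothM; first exact: sE.
  apply: msmoothD; first exact: dressing_p_smooth.
  apply: msmoothZ; first exact: csmooth_const.
  by apply: msmoothB; [exact: msmooth_const | exact: dressing_p_smooth].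
- move=> x t i j.
  apply: (@derivable_at_near _ (fun z => (E x t z *m dressing_factor x t z) i j)).
    (* The closed form of the inverse holds off two points, hence near [l], which suffices for
       derivability at [l]. *)
    have := near_neq lb; have := near_neq la; apply: filterS2 => z za zb.
    by rewrite dressed_E_factor.
  have -> : (fun z => (E x t z *m dressing_factor x t z) i j) = fun z =>
      E x t z i 0 * (p x t 0 j + (z - alpha) / (z - alpha^*) * (1%:M - p x t) 0 j) +
      E x t z i 1 * (p x t 1 j + (z - alpha) / (z - alpha^*) * (1%:M - p x t) 1 j).
    apply/funext => z; rewrite mulmx2E /dressing_factor.
    by congr (_ * _ + _ * _); rewrite mxE; congr (_ + _); rewrite mxE.
  have dB (c : C) : derivable_at (fun z : C => z - c) l.
    by apply: derivable_atD; [exact: derivable_at_id | exact: derivable_at_cst].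
  have dc : derivable_at (fun z : C => (z - alpha) / (z - alpha^*)) l.
    apply: derivable_atM; first exact: dB.
    by apply: derivable_atV; [rewrite subr_eq0 | exact: dB].
  have dfac a b : derivable_at
      (fun z : C => p x t a b + (z - alpha) / (z - alpha^*) * (1%:M - p x t) a b) l.
    apply: derivable_atD; first exact: derivable_at_cst.
    by apply: derivable_atM; [exact: dc | exact: derivable_at_cst].
  exact: (derivable_atD (derivable_atM (dE x t i 0) (dfac 0 j))
                        (derivable_atM (dE x t i 1) (dfac 1 j))).
- by move=> x t; split; [exact: Eu | exact: U].
Qed.

End Dressing.

(** * The corrected curve takes values in su(2) *)

Section SymCurve.
Context {R : realType}.
Notation C := R[i].

(** The coefficient is imaginary and [p - 1/2] is Hermitian, of trace 0 since [p] has trace 1; so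
    the correction is anti-Hermitian and trace-free. *)
Lemma sym_term_su2 (alpha : C) (phi p : 'M[C]_2) (v : 'cV[R]_3) :
  phi^t* *m phi = 1%:M -> p^t* = p -> \tr p = 1 ->
  let X := su2_of v - ((alpha - alpha^*) / `|alpha| ^+ 2) *:
    (phi *m (p - 2^-1 *: 1%:M) *m invmx phi) in
  su2_of (R3_of X) = X.
Proof.
move=> U pJ ptr X; rewrite /X unitary_invmx //.
have kJ : ((alpha - alpha^*) / `|alpha| ^+ 2)^* =
    - ((alpha - alpha^*) / `|alpha| ^+ 2).
  rewrite normCK rmorphM fmorphV rmorphM rmorphB /= conjCK.
  by rewrite [alpha^* * alpha]mulrC -mulNr opprB.
have YJ : (phi *m (p - 2^-1 *: 1%:M) *m phi^t*)^t* =
    phi *m (p - 2^-1 *: 1%:M) *m phi^t*.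
  rewrite !mulmxJ mxJK mxBJ pJ mxZJ mx1J fmorphV /= conjC_nat.
  by rewrite mulmxA.
have Ytr : \tr (phi *m (p - 2^-1 *: 1%:M) *m phi^t*) = 0.
  rewrite mxtrace_mulC mulmxA U mul1mx raddfB /= mxtraceZ ptr mxtrace1.
  by rewrite mulVf ?subrr // pnatr_eq0.
move: (phi *m _ *m _) YJ Ytr => Y YJ Ytr; apply: R3_ofK.
  by rewrite mxBJ su2_ofJ mxZJ kJ YJ scaleNr opprB opprK addrC.
by rewrite raddfB /= mxtraceZ Ytr mulr0 su2_of_tr subrr.
Qed.

End SymCurve.

Theorem theorem6p8 (R : realType)
  (gamma : R -> R -> 'cV[R]_3) (g : R -> R -> 'M[R]_3) (k1 k2 : R -> R -> R)
  (q : R -> R -> R[i]) (phi0 : 'M[R[i]]_2) (E : R -> R -> R[i] -> 'M[R[i]]_2)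
  (alpha : R[i]) (v0 : 'cV[R[i]]_2) (p : R -> R -> 'M[R[i]]_2)
  (gamma_flow : curve_flow gamma)
  (gamma_arc : forall t, arc_length (gamma ^~ t))
  (g_adapted : adapted_p_frame gamma g k1 k2)
  (q_def : forall x t, q x t = (k1 x t +i* k2 x t)%C / 2)
  (phi0_SU2 : SU2 phi0)
  (g00 : g 0 0 = Ad_delta phi0)
  (E_frame : frame_off [::] q E)
  (E00 : forall l, E 0 0 l = phi0)
  (alpha_nonreal : alpha \isn't Num.real)
  (v0_neq0 : v0 != 0)
  (p_proj : forall x t, herm_proj_onto (invmx (E x t alpha) *m v0) (p x t)) :
  let y := fun x t => invmx (E x t alpha) *m v0 in
  let phi := fun x t => E x t 0 in
  let pstar := fun x t => p x t - 2^-1 *: 1%:M in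
  let pperp := fun x t => 1%:M - p x t in
  let Gamma := fun x t => su2_of (gamma x t) -
    ((alpha - alpha^*) / `|alpha| ^+ 2) *:
      (phi x t *m pstar x t *m invmx (phi x t)) in
  let gamma' := fun x t => R3_of (Gamma x t) in
  let phi' := fun x t =>
    phi x t *m (p x t + (alpha / alpha^*) *: pperp x t) in
  let g' := fun x t => Ad_delta (phi' x t) in
  let k1' := fun x t => princ_curv 1 (g' ^~ t) x in
  let k2' := fun x t => princ_curv 2%:R (g' ^~ t) x in
  let q' := fun x t => (k1' x t +i* k2' x t)%C / 2 in
  let E' := fun x t l =>
    E x t l *m invmx (simple_factor alpha (p x t) l) in
  [/\ (* the right-hand side defining gamma' lies in su(2), and phi' in U(2) *)
      forall x t, su2_of (gamma' x t) = Gamma x t /\ phi' x t \is unitarymx,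
      curve_flow gamma' /\ (forall t, arc_length (gamma' ^~ t)),
      forall t, p_frame (gamma' ^~ t) (g' ^~ t),
      (forall x t, q' x t = q x t + 2 * ('i)%C * (alpha - alpha^*) *
          (y x t 0 0 * (y x t 1 0)^* /
             (`|y x t 0 0| ^+ 2 + `|y x t 1 0| ^+ 2)))
        /\ NLS q' &
      is_frame q' E'].
Proof.
move=> y phi pstar pperp Gamma gamma' phi' g' k1' k2' q' E'.
have a_neq : alpha != alpha^* by rewrite eq_sym -CrealE.
have a0 : alpha != 0.
  by apply: contra alpha_nonreal => /eqP ->; exact: rpred0.
have b0 : alpha^* != 0 by rewrite conjC_eq0.
have L : lax_frame q phi := lax_frame_q E_frame.
have [sphi U _ _] := L.
have gE x t : g x t = Ad_delta (phi x t).
  apply: (adapted_p_frame_Ad_delta g_adapted q_def L).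
  by rewrite g00 /phi E00.
have [sgam flow] := gamma_flow.
have Hx x t : pdx gamma x t = Adv (phi x t) (dvec 0).
  by case: g_adapted => _ <- _ _ _; rewrite gE col_Ad_delta.
have Ht x t : pdt gamma x t = Adv (phi x t) (uvec q x t).
  by rewrite flow (lax_frame_flow _ _ L Hx).
pose dq := dressed_q q E alpha v0.
have F : frame_off [:: alpha; alpha^*] dq E'.
  exact: dressed_frame E_frame v0_neq0 p_proj.
(* A non-real [alpha] is nonzero, so the dressed frame may be evaluated at 0, where the scalar in
   its factor is [alpha / conj alpha]. *)
have S0 : 0 \notin [:: alpha; alpha^*].
  by rewrite !inE negb_or ![0 == _]eq_sym a0 b0.
have phi'E x t : E' x t 0 = phi' x t.
  have -> : E' x t 0 = E x t 0 *m dressing_factor alpha p x t 0.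
    by apply: (dressed_E_factor p_proj); rewrite eq_sym.
  by rewrite /dressing_factor !sub0r invrN mulrNN.
have L' : lax_frame dq phi'.
  have -> : phi' = fun x t => E' x t 0.
    by apply/funext => x; apply/funext => t; rewrite phi'E.
  exact: lax_frame_of_frame_off F S0.
have [_ U' _ _] := L'.
have pJ x t : (p x t)^t* = p x t by case: (p_proj x t).
have sp : msmooth p := dressing_p_smooth E_frame v0_neq0 p_proj.
have ptr x t : \tr (p x t) = 1.
  have y0 := dressing_y_neq0 alpha E_frame v0_neq0 x t.
  have [-> _] := herm_proj_onto_mx2 y0 (p_proj x t).
  by rewrite /mxtrace sum2E !mx2E addrC subrK.
have GammaK x t : su2_of (gamma' x t) = Gamma x t.
  exact: sym_term_su2 (U x t) (pJ x t) (ptr x t).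
have sGamma : msmooth Gamma.
  have -> : Gamma = fun x t => su2_of (gamma x t) -
      ((alpha - alpha^*) / `|alpha| ^+ 2) *:
        (phi x t *m (p x t - 2^-1 *: 1%:M) *m (phi x t)^t*).
    by apply/funext => x; apply/funext => t; rewrite -unitary_invmx.
  apply: msmoothB; first exact: msmooth_su2_of.
  apply: msmoothZ; first exact: csmooth_const.
  apply: msmoothM; last exact: msmoothJ.
  by apply: msmoothM => //; apply: msmoothB => //; exact: msmooth_const.
have sgam' : smooth gamma' by exact: smooth_R3_of.
have su_a0 : su_a = su2_of (dvec 0) :> 'M[R[i]]_2 by rewrite -deltaE.
have Hx' x t : pdx gamma' x t = Adv (phi' x t) (dvec 0).
  rewrite AdvE -su_a0; apply: rderive_derive1; apply: rderive_R3_of.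
  have DX : mderive (fun r => su2_of (gamma r t)) x
      (phi x t *m su_a *m (phi x t)^t*).
    rewrite su_a0 -(AdvK _ (U x t)) -Hx; apply: mderive_su2_of.
    exact: (@derivable_rderive _ _ _ (gamma ^~ t) x
      (@smooth_derivable_x _ _ gamma x t sgam)).
  have Dphi := lax_frame_dx x t L; rewrite -lax_uE in Dphi.
  have WJ : (lax_u q x t)^t* = - lax_u q x t by rewrite lax_uE su2_ofJ.
  exact: (mderive_sym a0 (U ^~ t) Dphi WJ (msmooth_mderive_x x t sp) (pJ x t) DX
    (dressing_sym_x E_frame v0_neq0 p_proj x t)).
have Ht' x t : pdt gamma' x t = Adv (phi' x t) (uvec dq x t).
  rewrite AdvE -lax_uE; apply: rderive_derive1; apply: rderive_R3_of.
  have DX : mderive (fun r => su2_of (gamma x r)) t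
      (phi x t *m lax_u q x t *m (phi x t)^t*).
    rewrite lax_uE -(AdvK _ (U x t)) -Ht; apply: mderive_su2_of.
    exact: (@derivable_rderive _ _ _ (gamma x) t
      (@smooth_derivable_t _ _ gamma x t sgam)).
  have Dphi := lax_frame_dt x t L; rewrite -lax_QE in Dphi.
  have WJ : (lax_Q q x t)^t* = - lax_Q q x t by rewrite lax_QE su2_ofJ.
  exact: (mderive_sym a0 (U x) Dphi WJ (msmooth_mderive_t x t sp) (pJ x t) DX
    (dressing_sym_t E_frame v0_neq0 p_proj x t)).
have [flow' frame' curv'] := lax_frame_curve L' sgam' Hx' Ht'.
(* [q'] is read off the curvatures of the new frame, which are twice the real and imaginary parts of
   the dressed potential. *)
have q'E : q' = dq.
  apply/funext => x; apply/funext => t; have [k1E k2E] := curv' x t.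
  have -> : q' x t = ((2 * complex.Re (dq x t)) +i* (2 * complex.Im (dq x t)))%C / 2.
    by rewrite -k1E -k2E.
  rewrite -[2 : R[i]](rmorph_nat (real_complex R)) -fmorphV; apply/eqP.
  by rewrite eq_complex /=; apply/andP; split; apply/eqP; field.
rewrite q'E; split.
- move=> x t; split; first exact: GammaK.
  by apply/unitarymxP; exact: mulmx1C.
- exact: flow'.
- exact: frame'.
- by split=> //; exact: NLS_of_lax_frame L'.
- exists [:: alpha; alpha^*]; split=> [l|l|].
  + by rewrite !inE => /orP[] /eqP ->; rewrite ?conjCK eqxx ?orbT.
  + rewrite !inE => /orP[] /eqP -> //.
    by rewrite CrealE conjCK.
  + exact: F.
Qed.
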